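(* Let $k=3$, let $p$ be a prime with $p\equiv1\pmod 3$, let $q\geq 2$ be an integer and $\theta=\exp_p(J)$ with $0<|\theta-1|_p<|q|_p<1$, and write $q=\frac{q^*}{|q|_p}$ with $p\nmid q^*$. Let $m\ge1$ be an integer. Then there exist $H_m$-periodic $p$-adic Gibbs measures of the $q$-states Potts model on the Cayley tree of order three as follows. For every $h\in\mathcal{E}_p$ and every partition $\{1,\dots,q-1\}=\alpha\sqcup\beta$ with $|\alpha|\ge1$ (so $|\alpha|+|\beta|=q-1$) and $$|\alpha|\notin\left\{\tfrac{1}{|q|_p},\tfrac{2}{|q|_p},\dots,\tfrac{q^*-1}{|q|_p}\right\},$$ there is an $m$-cycle $\{z^{(j)}\}_{j=0}^{m-1}\subset\mathcal{E}_p$ of the mapping $$G_{\theta,\alpha,q,3}(z)=\left(\frac{(\theta+|\alpha|-1)z+q-|\alpha|}{|\alpha|z+\theta+q-|\alpha|-1}\right)^3$$ such that, with $\mathbf{z}^{(j)}=(z_1^{(j)},\dots,z_{q-1}^{(j)})=z^{(j)}\mathbf{e}_\alpha+\mathbf{e}_\beta\in\mathcal{E}_p^{q-1}$ and $$\tilde{\mathbf{h}}^{(j)}=\left(\ln_p(hz_1^{(j)}),\dots,\ln_p(hz_{q-1}^{(j)}),\ln_p(h)\right),\qquad 0\le j\le m-1,$$ there is an $H_m$-periodic $p$-adic Gibbs measure associated with the $m$-periodic boundary function $\{\tilde{\mathbf{h}}^{(j)}\}_{j=0}^{m-1}$.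
   Context: $\mathcal{E}_p=\{x\in\mathbb{Q}_p:|x-1|_p<p^{-1/(p-1)}\}$; $\exp_p$ and $\ln_p$ are the $p$-adic exponential and logarithm; $J\in\mathbb{Q}_p$ with $|J|_p<p^{-1/(p-1)}$ is a coupling constant. For $\alpha\subset\{1,\dots,q-1\}$, $\mathbf{e}_\alpha\in\mathbb{Q}_p^{q-1}$ is the indicator vector of $\alpha$, and $|\alpha|$ is its cardinality. An $m$-cycle of $G$ is a family $\{z^{(j)}\}_{j=0}^{m-1}$ of $m$ distinct points with $z^{(j)}=G(z^{(j+1)})$ for $0\le j\le m-1$, where $z^{(m)}:=z^{(0)}$. The model. Let $\Gamma^k_+=(V,L)$ be the semi-infinite Cayley tree of order $k$ with root $x^0$ (the root has $k$ edges, every other vertex has $k+1$), with graph distance $d$; $W_n=\{x\in V:d(x,x^0)=n\}$, $V_n=\bigcup_{i=0}^nW_i$, $L_n$ is the set of edges with both endpoints in $V_n$. Let $\Phi=\{1,\dots,q\}$, $\Omega=\Phi^V$, $\Omega_{V_n}=\Phi^{V_n}$, $\Omega_{W_n}=\Phi^{W_n}$; for $\sigma_{n-1}\in\Omega_{V_{n-1}}$, $\sigma^{(n)}\in\Omega_{W_n}$, $\sigma_{n-1}\vee\sigma^{(n)}\in\Omega_{V_n}$ is their concatenation. The Hamiltonian is $H_n(\sigma_n)=J\sum_{\langle x,y\rangle\in L_n}\delta_{\sigma_n(x)\sigma_n(y)}$ ($\delta$ the Kronecker symbol). A boundary function is a map $\tilde{\mathbf{h}}:V\to\mathbb{Q}_p^q$,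 $\tilde{\mathbf{h}}(x)=(\tilde h^{(1)}_x,\dots,\tilde h^{(q)}_x)$, with all components of absolute value $<p^{-1/(p-1)}$. It defines $$\mu^{(n)}_{\tilde{\mathbf{h}}}(\sigma_n)=\frac{1}{\mathcal{Z}^{(n)}_{\tilde{\mathbf{h}}}}\exp_p\Big\{H_n(\sigma_n)+\sum_{x\in W_n}\tilde h_x^{(\sigma_n(x))}\Big\},\qquad \sigma_n\in\Omega_{V_n},\ n\ge 0,$$ where $\mathcal{Z}^{(n)}_{\tilde{\mathbf{h}}}$ is the sum of the exponentials over all $\sigma_n\in\Omega_{V_n}$ (required to be nonzero). These are compatible if $\sum_{\sigma^{(n)}\in\Omega_{W_n}}\mu^{(n)}_{\tilde{\mathbf{h}}}(\sigma_{n-1}\vee\sigma^{(n)})=\mu^{(n-1)}_{\tilde{\mathbf{h}}}(\sigma_{n-1})$ for all $n\ge1$ and $\sigma_{n-1}\in\Omega_{V_{n-1}}$. In that case there is a unique finitely additive $\mathbb{Q}_p$-valued measure $\mu_{\tilde{\mathbf{h}}}$ on the algebra of cylinder subsets of $\Omega$ with $\mu_{\tilde{\mathbf{h}}}(\{\sigma|_{V_n}=\sigma_n\})=\mu^{(n)}_{\tilde{\mathbf{h}}}(\sigma_n)$; it is called the $p$-adic Gibbs measure associated with $\tilde{\mathbf{h}}$. The boundary function is $m$-periodic, given by $\{\tilde{\mathbf{h}}^{(j)}\}_{j=0}^{m-1}$, if $\tilde{\mathbf{h}}(x)=\tilde{\mathbf{h}}^{(j)}$ whenever $d(x,x^0)\equiv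 j\pmod m$, $0\le j<m$; a $p$-adic Gibbs measure associated with an $m$-periodic boundary function is called $H_m$-periodic. *)

(* Defs.v *)
From HB Require Import structures.
From mathcomp Require Import all_boot all_order all_algebra generic_quotient ring_quotient.
From mathcomp Require Import ring.
From mathcomp Require Import all_classical all_reals all_analysis.

Set Implicit Arguments.
Unset Strict Implicit.
Unset Printing Implicit Defensive.

Import Order.TTheory GRing.Theory Num.Theory.

Local Open Scope classical_set_scope.
Local Open Scope ring_scope.

Definition int_padic_abs (p : nat) (a : int) : rat :=
  if a == 0 then 0 else p%:R ^- logn p `|a|.

(* For [p] not prime, [logn p] vanishes and this is the trivial absolute value,
   so that the construction of ['Q_[p]] needs no proof of [prime p]. *)
Definition rat_padic_abs (p : nat) (x : rat) : rat :=
  int_padic_abs p (numq x) / int_padic_abs p (denq x).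

Section RatPadicAbs.
Variable p : nat.
Local Notation ia := (int_padic_abs p).
Local Notation ra := (rat_padic_abs p).

Lemma logn_gt0_natr (n : nat) : (p%:R : rat) ^+ logn p n != 0.
Proof.
rewrite expf_eq0 pnatr_eq0; case: (posnP p) => [->|]; last by rewrite andbF.
by rewrite lognE.
Qed.

Lemma int_padic_abs_gt0 a : a != 0 -> 0 < ia a.
Proof.
move=> a0; rewrite /ia (negbTE a0) invr_gt0 lt0r logn_gt0_natr.
by rewrite exprn_ge0 ?ler0n.
Qed.

Lemma int_padic_abs_eq0 a : (ia a == 0) = (a == 0).
Proof.
have [->|a0] := eqVneq a 0; first by rewrite /ia eqxx.
by rewrite gt_eqF ?int_padic_abs_gt0.
Qed.

Lemma int_padic_absM a b : ia (a * b) = ia a * ia b.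
Proof.
rewrite /ia mulf_eq0.
have [->|a0] := eqVneq a 0; first by rewrite /= mul0r.
have [->|b0] := eqVneq b 0; first by rewrite orbT mulr0.
by rewrite /= abszM lognM ?absz_gt0// exprD invfM.
Qed.

Lemma int_padic_absN a : ia (- a) = ia a.
Proof. by rewrite /ia oppr_eq0 abszN. Qed.

Lemma int_padic_abs1 : ia 1 = 1.
Proof. by rewrite /ia /= logn1 expr0 invr1. Qed.

Lemma int_padic_absD a b : ia (a + b) <= Num.max (ia a) (ia b).
Proof.
have [->|a0] := eqVneq a 0; first by rewrite add0r le_max lexx orbT.
have [->|b0] := eqVneq b 0; first by rewrite addr0 le_max lexx.
have [ab0|ab0] := eqVneq (a + b) 0.
  by rewrite ab0 {1}/ia eqxx le_max ltW ?int_padic_abs_gt0.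
have [pp|/negbTE npp] := boolP (prime p); last first.
  have L n : logn p n = 0%N by rewrite lognE npp.
  by rewrite /ia (negbTE a0) (negbTE b0) (negbTE ab0) !L maxxx.
have p1 : 1 < p%:R :> rat by rewrite ltr1n prime_gt1.
wlog ab : a b a0 b0 ab0 / (logn p `|a| <= logn p `|b|)%N.
  move=> W; have [h|/ltnW h] := leqP (logn p `|a|) (logn p `|b|); first exact: W.
  by rewrite addrC maxC W// addrC.
rewrite /ia (negbTE a0) (negbTE b0) (negbTE ab0) le_max.
apply/orP; left.
rewrite lef_pV2 ?posrE ?exprn_gt0 ?(lt_trans ltr01)//.
rewrite ler_eXn2l// -pfactor_dvdn ?absz_gt0//.
suff : ((p ^ logn p `|a|)%N%:Z %| a + b)%Z by [].
by apply: rpredD; rewrite dvdzE /= pfactor_dvdn ?absz_gt0//.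
Qed.

Lemma rat_padic_abs_frac (a b : int) : b != 0 ->
  ra (a%:~R / b%:~R) = ia a / ia b.
Proof.
move=> b0; set x := _ / _.
have bq : b%:~R != 0 :> rat by rewrite intr_eq0.
have E : numq x * b = a * denq x.
  apply/eqP; rewrite -(eqr_int rat) !intrM.
  have := divq_num_den x; rewrite {3}/x => /eqP.
  by rewrite eqr_div ?intr_eq0 ?denq_eq0// => /eqP ->.
rewrite /ra; apply/eqP; rewrite eqr_div ?int_padic_abs_eq0 ?denq_eq0//.
by rewrite -!int_padic_absM E.
Qed.

Lemma rat_padic_absM x y : ra (x * y) = ra x * ra y.
Proof.
rewrite -[in LHS](divq_num_den x) -[in LHS](divq_num_den y) mulf_div -!intrM.
rewrite rat_padic_abs_frac ?mulf_neq0 ?denq_eq0// !int_padic_absM.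
by rewrite -mulf_div.
Qed.

Lemma rat_padic_absD x y : ra (x + y) <= Num.max (ra x) (ra y).
Proof.
rewrite -[in X in X <= _](divq_num_den x) -[in X in X <= _](divq_num_den y).
rewrite addf_div ?intr_eq0 ?denq_eq0// -!intrM -intrD.
rewrite rat_padic_abs_frac ?mulf_neq0 ?denq_eq0//.
have dx : 0 < ia (denq x) by rewrite int_padic_abs_gt0// denq_eq0.
have dy : 0 < ia (denq y) by rewrite int_padic_abs_gt0// denq_eq0.
rewrite int_padic_absM ler_pdivrMr ?mulr_gt0//.
apply: le_trans (int_padic_absD _ _) _; rewrite !int_padic_absM.
rewrite maxr_pMl; last by rewrite mulr_ge0// ltW.
rewrite /ra.
rewrite ge_max !le_max; apply/andP; split; apply/orP; [left|right].
  by rewrite mulrA mulfVK ?gt_eqF.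
by rewrite [ia (denq x) * _]mulrC mulrA mulfVK ?gt_eqF.
Qed.

Lemma rat_padic_abs0 : ra 0 = 0.
Proof. by rewrite /ra /= {1}/ia eqxx mul0r. Qed.

Lemma rat_padic_abs1 : ra 1 = 1.
Proof. by rewrite /ra /= int_padic_abs1 divff ?oner_eq0. Qed.

Lemma rat_padic_abs_ge0 x : 0 <= ra x.
Proof.
have ge0 a : 0 <= ia a.
  have [->|a0] := eqVneq a 0; first by rewrite /ia eqxx.
  by rewrite ltW ?int_padic_abs_gt0.
by rewrite divr_ge0.
Qed.

Lemma rat_padic_abs_eq0 x : (ra x == 0) = (x == 0).
Proof. by rewrite mulf_eq0 invr_eq0 !int_padic_abs_eq0 denq_eq0 orbF numq_eq0. Qed.

Lemma rat_padic_absN x : ra (- x) = ra x.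
Proof. by rewrite /ra numqN denqN int_padic_absN. Qed.

Lemma rat_padic_distC x y : ra (x - y) = ra (y - x).
Proof. by rewrite -rat_padic_absN opprB. Qed.

Lemma rat_padic_absB x y : ra (x - y) <= Num.max (ra x) (ra y).
Proof. by rewrite -[ra y]rat_padic_absN rat_padic_absD. Qed.

Lemma rat_padic_absV x : ra x^-1 = (ra x)^-1.
Proof.
have [->|x0] := eqVneq x 0; first by rewrite invr0 rat_padic_abs0 invr0.
apply: (mulfI (x := ra x)); first by rewrite rat_padic_abs_eq0.
by rewrite -rat_padic_absM !divff ?rat_padic_abs_eq0// rat_padic_abs1.
Qed.

Lemma rat_padic_abs_near x y : ra (x - y) < ra y -> ra x = ra y.
Proof.
move=> h; apply/eqP; rewrite eq_le; apply/andP; split.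
  rewrite -[x](subrK y) (le_trans (rat_padic_absD _ _))//.
  by rewrite ge_max lexx (ltW h).
have := rat_padic_absB x (x - y); rewrite opprB addrCA subrr addr0.
by rewrite le_max => /orP[//|]; rewrite leNgt h.
Qed.

Lemma rat_padic_abs_prime : prime p -> ra p%:R = p%:R^-1.
Proof.
move=> pp; rewrite /ra (_ : p%:R = (p : int)%:~R :> rat)// numq_int denq_int.
rewrite int_padic_abs1 divr1.
by rewrite /ia eqz_nat (gtn_eqF (prime_gt0 pp)) absz_nat logn_prime// eqxx.
Qed.

End RatPadicAbs.

Definition padic_cauchy (p : nat) (u : nat -> rat) : Prop :=
  forall e : rat, 0 < e -> exists N, forall m n, (N <= m)%N -> (N <= n)%N ->
    rat_padic_abs p (u m - u n) < e.

Definition padic_null (p : nat) (u : nat -> rat) : Prop :=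
  forall e : rat, 0 < e -> exists N, forall n, (N <= n)%N ->
    rat_padic_abs p (u n) < e.

Section CauchySeq.
Variable p : nat.
Local Notation ra := (rat_padic_abs p).

Lemma padic_cauchy_bounded (u : nat -> rat) : padic_cauchy p u ->
  exists2 B, 0 < B & exists N, forall n, (N <= n)%N -> ra (u n) <= B.
Proof.
move=> /(_ 1 ltr01)[N uN]; exists (Num.max 1 (ra (u N))).
  by rewrite lt_max ltr01.
exists N => n Nn; rewrite -[u n](subrK (u N)).
apply: le_trans (rat_padic_absD _ _ _) _.
rewrite ge_max; apply/andP; split; last by rewrite le_max lexx orbT.
by rewrite le_max ltW// uN.
Qed.

Definition cauchy_pred : {pred (nat -> rat)} := fun u => `[< padic_cauchy p u >].

Lemma cauchy_pred_subring : subring_closed cauchy_pred.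
Proof.
split=> [|u v /asboolP cu /asboolP cv|u v /asboolP cu /asboolP cv]; apply/asboolP.
- by move=> e e0; exists 0%N => m n _ _; rewrite subrr rat_padic_abs0.
- move=> e e0; have [M cuM] := cu e e0; have [N cvN] := cv e e0.
  exists (maxn M N) => m n; rewrite !geq_max => /andP[Mm Nm] /andP[Mn Nn].
  have -> : (u - v) m - (u - v) n = (u m - u n) - (v m - v n).
    by rewrite !fctE; ring.
  apply: le_lt_trans (rat_padic_absB _ _ _) _.
  by rewrite gt_max cuM// cvN.
- have [B B0 [NB uB]] := padic_cauchy_bounded cu.
  have [C C0 [NC vC]] := padic_cauchy_bounded cv.
  move=> e e0; have [M cuM] := cu (e / C) (divr_gt0 e0 C0).
  have [N cvN] := cv (e / B) (divr_gt0 e0 B0).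
  exists (maxn (maxn M N) (maxn NB NC)) => m n.
  rewrite !geq_max => /andP[/andP[Mm Nm] /andP[Bm Cm]].
  move=> /andP[/andP[Mn Nn] /andP[Bn Cn]].
  have -> : (u * v) m - (u * v) n = u m * (v m - v n) + (u m - u n) * v n.
    by rewrite !fctE; ring.
  apply: le_lt_trans (rat_padic_absD _ _ _) _.
  rewrite gt_max !rat_padic_absM; apply/andP; split.
    have h := cvN _ _ Nm Nn; rewrite ltr_pdivlMr// in h.
    apply: le_lt_trans h; rewrite mulrC ler_wpM2l ?rat_padic_abs_ge0//.
    exact: uB.
  have h := cuM _ _ Mm Mn; rewrite ltr_pdivlMr// in h.
  apply: le_lt_trans h; rewrite ler_wpM2l ?rat_padic_abs_ge0//.
  exact: vC.
Qed.

HB.instance Definition _ :=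
  GRing.isSubringClosed.Build (nat -> rat) cauchy_pred cauchy_pred_subring.

Record cauchy_seq := CauchySeq {
  cauchy_val :> nat -> rat;
  cauchy_valP : cauchy_val \in cauchy_pred }.

HB.instance Definition _ := [isSub for cauchy_val].
HB.instance Definition _ := [Choice of cauchy_seq by <:].
HB.instance Definition _ := [SubChoice_isSubComNzRing of cauchy_seq by <:].

Lemma cauchy_seqP (u : cauchy_seq) : padic_cauchy p u.
Proof. by have /asboolP := cauchy_valP u. Qed.

Definition null_pred : {pred cauchy_seq} := fun u => `[< padic_null p u >].

Lemma null_predP : idealr_closed null_pred.
Proof.
split=> [||u v w /asboolP nv /asboolP nw]; first apply/asboolP.
- by move=> e e0; exists 0%N => n _; rewrite /= rat_padic_abs0.
- apply/negP => /asboolP /(_ 1 ltr01)[N /(_ N (leqnn N))].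
  by rewrite /= rat_padic_abs1 ltxx.
- have [B B0 [NB uB]] := padic_cauchy_bounded (cauchy_seqP u).
  apply/asboolP => e e0.
  have [M vM] := nv (e / B) (divr_gt0 e0 B0).
  have [N wN] := nw e e0.
  exists (maxn M (maxn N NB)) => n.
  rewrite !geq_max => /and3P[Mn Nn Bn].
  rewrite /= !fctE.
  apply: le_lt_trans (rat_padic_absD _ _ _) _.
  rewrite gt_max wN// andbT rat_padic_absM.
  have h := vM _ Mn; rewrite ltr_pdivlMr// in h.
  apply: le_lt_trans h; rewrite mulrC ler_wpM2l ?rat_padic_abs_ge0//.
  exact: uB.
Qed.

HB.instance Definition _ := isIdealr.Build cauchy_seq null_pred null_predP.

Lemma padic_cauchy_abs_stationary (u : nat -> rat) : padic_cauchy p u -> ~ padic_null p u ->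
  exists2 c, 0 < c & exists N, forall n, (N <= n)%N -> ra (u n) = c.
Proof.
move=> cu /existsNP[e /not_implyP[e0 /forallNP nu]].
have [N uN] := cu e e0.
have /existsNP[n0 /not_implyP[Nn0 /negP]] := nu N.
rewrite -leNgt => en0.
exists (ra (u n0)); first exact: lt_le_trans en0.
exists N => n Nn; apply: rat_padic_abs_near.
by apply: lt_le_trans en0; exact: uN.
Qed.

Lemma padic_cauchy_inv (u : nat -> rat) : padic_cauchy p u -> ~ padic_null p u ->
  padic_cauchy p (fun n => (u n)^-1).
Proof.
move=> cu nu; have [c c0 [N uN]] := padic_cauchy_abs_stationary cu nu.
move=> e e0; have [M cuM] := cu (e * c ^+ 2) (mulr_gt0 e0 (exprn_gt0 2 c0)).
exists (maxn M N) => m n; rewrite !geq_max => /andP[Mm Nm] /andP[Mn Nn].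
have un0 k : (N <= k)%N -> u k != 0.
  by move=> Nk; rewrite -(rat_padic_abs_eq0 p) uN// gt_eqF.
have -> : (u m)^-1 - (u n)^-1 = (u n - u m) / (u m * u n).
  by field; rewrite !un0.
rewrite rat_padic_absM rat_padic_absV rat_padic_absM !uN// -expr2.
by rewrite ltr_pdivrMr ?exprn_gt0// cuM.
Qed.

End CauchySeq.

Arguments cauchy_pred : clear implicits.
Arguments null_pred : clear implicits.

Definition Qp (p : nat) : Type := {ideal_quot (null_pred p)}.

Notation "''Q_[' p ]" := (Qp p) (at level 8, format "''Q_[' p ]") : type_scope.

HB.instance Definition _ (p : nat) := GRing.ComNzRing.on 'Q_[p].

Section QpField.
Variable p : nat.
Local Notation ra := (rat_padic_abs p).
Local Open Scope quotient_scope.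

Definition Qp_of (u : cauchy_seq p) : 'Q_[p] := \pi_{ideal_quot null_pred p} u.

Lemma Qp_of_is_zmod_morphism : zmod_morphism Qp_of.
Proof. exact: pi_is_zmod_morphism. Qed.

Lemma Qp_of_is_monoid_morphism : monoid_morphism Qp_of.
Proof. exact: pi_is_monoid_morphism. Qed.

HB.instance Definition _ :=
  GRing.isZmodMorphism.Build (cauchy_seq p) 'Q_[p] Qp_of Qp_of_is_zmod_morphism.
HB.instance Definition _ :=
  GRing.isMonoidMorphism.Build (cauchy_seq p) 'Q_[p] Qp_of
    Qp_of_is_monoid_morphism.

Lemma Qp_of_surj (x : 'Q_[p]) : exists u, x = Qp_of u.
Proof. by exists (repr x); rewrite /Qp_of reprK. Qed.

Lemma Qp_of_eq0 (u : cauchy_seq p) : Qp_of u = 0 <-> padic_null p u.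
Proof.
have -> : (Qp_of u = 0) <-> (Qp_of u == 0) by split=> [->|/eqP].
rewrite -(rmorph0 Qp_of) -Quotient.idealrBE subr0.
by split=> [/asboolP|h]//; apply/asboolP.
Qed.

Lemma Qp_inv_exists (x : 'Q_[p]) : x != 0 -> exists y : 'Q_[p], y * x = 1.
Proof.
have [u ->] := Qp_of_surj x => /eqP u0.
have nu : ~ padic_null p u by rewrite -Qp_of_eq0.
have cv := padic_cauchy_inv (cauchy_seqP u) nu.
pose v := CauchySeq (asboolT cv : _ \in cauchy_pred p).
exists (Qp_of v); rewrite -rmorphM -(rmorph1 Qp_of).
apply/eqP; rewrite -subr_eq0 -rmorphB; apply/eqP/Qp_of_eq0 => e e0.
have [c c0 [N uN]] := padic_cauchy_abs_stationary (cauchy_seqP u) nu.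
exists N => n Nn; rewrite /= !fctE mulVf ?subrr ?rat_padic_abs0//.
by rewrite -(rat_padic_abs_eq0 p) uN// gt_eqF.
Qed.

Definition Qp_inv (x : 'Q_[p]) : 'Q_[p] :=
  if x == 0 then 0 else xget 0 [set y | y * x = 1].

Lemma Qp_mulVf x : x != 0 -> Qp_inv x * x = 1.
Proof.
move=> x0; rewrite /Qp_inv (negbTE x0).
have [y yx] := Qp_inv_exists x0.
by case: xgetP => [z _ //|/(_ y)].
Qed.

Lemma Qp_inv0 : Qp_inv 0 = 0. Proof. by rewrite /Qp_inv eqxx. Qed.

HB.instance Definition _ := GRing.ComNzRing_isField.Build 'Q_[p] Qp_mulVf Qp_inv0.

(* An element represented by [u] has absolute value the eventual value of
   [|u n|], which exists unless [u] is null. *)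
Definition padic_abs (x : 'Q_[p]) : rat :=
  xget 0 [set c | exists2 u, x = Qp_of u &
    exists N, forall n, (N <= n)%N -> ra (u n) = c].

Lemma Qp_of_eq (u v : cauchy_seq p) :
  Qp_of u = Qp_of v <-> padic_null p (fun n => u n - v n).
Proof.
rewrite (_ : (fun n => _) = (u - v)%R)// -Qp_of_eq0 rmorphB /=.
by split=> [->|/eqP]; rewrite ?subrr// subr_eq0 => /eqP.
Qed.

Lemma padic_null_close (u v : nat -> rat) c :
  padic_null p (fun n => u n - v n) -> 0 < c ->
  (exists N, forall n, (N <= n)%N -> ra (v n) = c) ->
  exists N, forall n, (N <= n)%N -> ra (u n) = c.
Proof.
move=> nuv c0 [N vN]; have [M uvM] := nuv c c0.
exists (maxn M N) => n; rewrite geq_max => /andP[Mn Nn].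
by rewrite -(vN n)//; apply: rat_padic_abs_near; rewrite vN// uvM.
Qed.

Lemma padic_abs_of (u : cauchy_seq p) c :
  (exists N, forall n, (N <= n)%N -> ra (u n) = c) -> padic_abs (Qp_of u) = c.
Proof.
have uniq_val (w : nat -> rat) a b :
    (exists N, forall n, (N <= n)%N -> ra (w n) = a) ->
    (exists N, forall n, (N <= n)%N -> ra (w n) = b) -> a = b.
  by move=> [M wM] [N wN]; rewrite -(wM (maxn M N)) ?leq_maxl// wN ?leq_maxr.
have ge0 (w : nat -> rat) a :
    (exists N, forall n, (N <= n)%N -> ra (w n) = a) -> 0 <= a.
  by move=> [N wN]; rewrite -(wN N)// rat_padic_abs_ge0.
move=> uc; rewrite /padic_abs; case: xgetP => [d _|/(_ c)]; last first.
  by case; exists u.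
move=> [v uv vd].
have := ge0 _ _ vd; rewrite le_eqVlt => /orP[/eqP d0|d0].
  have := ge0 _ _ uc; rewrite le_eqVlt => /orP[/eqP<-//|c0].
  have /Qp_of_eq nvu := esym uv.
  exact: uniq_val vd (padic_null_close nvu c0 uc).
move: uv => /Qp_of_eq nuv.
exact: esym (uniq_val _ _ _ uc (padic_null_close nuv d0 vd)).
Qed.

(* Every element is 0 or has a representative of eventually constant
   absolute value. *)
Lemma Qp_of_absP (u : cauchy_seq p) :
  (Qp_of u = 0 /\ padic_abs (Qp_of u) = 0) \/
  (Qp_of u != 0 /\ 0 < padic_abs (Qp_of u) /\
   exists N, forall n, (N <= n)%N -> ra (u n) = padic_abs (Qp_of u)).
Proof.
have [/Qp_of_eq0 u0|nu] := pselect (padic_null p u).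
  left; split=> //; rewrite u0 -(rmorph0 Qp_of); apply: padic_abs_of.
  by exists 0%N => n _; rewrite rat_padic_abs0.
have [c c0 uc] := padic_cauchy_abs_stationary (cauchy_seqP u) nu.
right; rewrite (padic_abs_of uc); split=> //.
by apply/eqP => /Qp_of_eq0.
Qed.

Lemma padic_abs_lt (u : cauchy_seq p) e : 0 < e -> padic_abs (Qp_of u) < e ->
  exists N, forall n, (N <= n)%N -> ra (u n) < e.
Proof.
move=> e0; have [[/Qp_of_eq0 nu _ _]|[_ [_ [N uN]]] ce] := Qp_of_absP u.
  exact: nu.
by exists N => n Nn; rewrite uN.
Qed.

Lemma padic_abs_le (u : cauchy_seq p) e : 0 <= e ->
  (exists N, forall n, (N <= n)%N -> ra (u n) <= e) -> padic_abs (Qp_of u) <= e.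
Proof.
move=> e0 [M uM]; have [[_ ->]//|[_ [_ [N uN]]]] := Qp_of_absP u.
by rewrite -(uN (maxn M N)) ?leq_maxr// uM ?leq_maxl.
Qed.

Lemma padic_abs_ge0 x : 0 <= padic_abs x.
Proof.
by have [u ->] := Qp_of_surj x; have [[_ ->]//|[_ [/ltW]]] := Qp_of_absP u.
Qed.

Lemma padic_abs_eq0 x : (padic_abs x == 0) = (x == 0).
Proof.
have [u ->] := Qp_of_surj x; have [[-> ->]|] := Qp_of_absP u; first by rewrite !eqxx.
by move=> [/negbTE -> [/gt_eqF ->]].
Qed.

Lemma padic_abs0 : padic_abs 0 = 0.
Proof. by apply/eqP; rewrite padic_abs_eq0. Qed.

Lemma padic_absM x y : padic_abs (x * y) = padic_abs x * padic_abs y.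
Proof.
have [->|x0] := eqVneq x 0; first by rewrite padic_abs0 !mul0r padic_abs0.
have [->|y0] := eqVneq y 0; first by rewrite padic_abs0 !mulr0 padic_abs0.
move: x0 y0; have [u ->] := Qp_of_surj x; have [v ->] := Qp_of_surj y.
have [[-> _]|[_ [_ [M uM]]] _] := Qp_of_absP u; first by rewrite eqxx.
have [[-> _]|[_ [_ [N vN]]] _] := Qp_of_absP v; first by rewrite eqxx.
rewrite -rmorphM; apply: padic_abs_of; exists (maxn M N) => n.
by rewrite geq_max => /andP[Mn Nn]; rewrite rat_padic_absM uM// vN.
Qed.

Lemma padic_absD x y : padic_abs (x + y) <= Num.max (padic_abs x) (padic_abs y).
Proof.
have [->|x0] := eqVneq x 0; first by rewrite add0r le_max lexx orbT.
have [->|y0] := eqVneq y 0; first by rewrite addr0 le_max lexx.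
move: x0 y0; have [u ->] := Qp_of_surj x; have [v ->] := Qp_of_surj y.
have [[-> _]|[_ [_ [M uM]]] _] := Qp_of_absP u; first by rewrite eqxx.
have [[-> _]|[_ [_ [N vN]]] _] := Qp_of_absP v; first by rewrite eqxx.
rewrite -rmorphD; apply: padic_abs_le; first by rewrite le_max padic_abs_ge0.
exists (maxn M N) => n; rewrite geq_max => /andP[Mn Nn].
by rewrite -(uM n)// -(vN n)// rat_padic_absD.
Qed.

Lemma padic_abs1 : padic_abs 1 = 1.
Proof.
by rewrite -(rmorph1 Qp_of); apply: padic_abs_of; exists 0%N => n _; rewrite rat_padic_abs1.
Qed.

Lemma padic_absN x : padic_abs (- x) = padic_abs x.
Proof.
have sq1 : padic_abs (-1) ^+ 2 = 1 by rewrite expr2 -padic_absM mulrNN mulr1 padic_abs1.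
have /eqP N1 : padic_abs (-1) == 1 by rewrite -(eqrXn2 (n := 2)) ?padic_abs_ge0// sq1 expr1n.
by rewrite -mulN1r padic_absM N1 mul1r.
Qed.

Lemma padic_distC x y : padic_abs (x - y) = padic_abs (y - x).
Proof. by rewrite -padic_absN opprB. Qed.

Lemma cst_padic_cauchy (r : rat) : (fun=> r) \in cauchy_pred p.
Proof.
by apply/asboolP => e e0; exists 0%N => m n _ _; rewrite subrr rat_padic_abs0.
Qed.

Definition cst_cauchy_seq r : cauchy_seq p := CauchySeq (cst_padic_cauchy r).

Lemma cst_cauchy_seq_is_zmod_morphism : zmod_morphism cst_cauchy_seq.
Proof. by move=> r s; apply: val_inj. Qed.

Lemma cst_cauchy_seq_is_monoid_morphism : monoid_morphism cst_cauchy_seq.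
Proof. by split=> [|r s]; apply: val_inj. Qed.

HB.instance Definition _ := GRing.isZmodMorphism.Build rat (cauchy_seq p)
  cst_cauchy_seq cst_cauchy_seq_is_zmod_morphism.
HB.instance Definition _ := GRing.isMonoidMorphism.Build rat (cauchy_seq p)
  cst_cauchy_seq cst_cauchy_seq_is_monoid_morphism.

Lemma Qp_of_cst r : Qp_of (cst_cauchy_seq r) = ratr r.
Proof. exact: (fmorph_eq_rat (Qp_of \o cst_cauchy_seq)). Qed.

Lemma padic_abs_ratr (r : rat) : padic_abs (ratr r) = ra r.
Proof. by rewrite -Qp_of_cst; apply: padic_abs_of; exists 0%N. Qed.

Lemma padic_abs_nat (n : nat) : padic_abs n%:R = ra n%:R.
Proof.
by rewrite -padic_abs_ratr -Qp_of_cst !rmorph_nat.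
Qed.

Lemma Qp_natr_eq0 (n : nat) : (n%:R == 0 :> 'Q_[p]) = (n == 0)%N.
Proof. by rewrite -padic_abs_eq0 padic_abs_nat rat_padic_abs_eq0 pnatr_eq0. Qed.

Lemma ratr_dense (x : 'Q_[p]) e : 0 < e -> exists r : rat, padic_abs (x - ratr r) < e.
Proof.
move=> e0; have [u ->] := Qp_of_surj x.
have e2 : 0 < e / 2 by rewrite divr_gt0.
have [N uN] := cauchy_seqP u e2.
exists (u N); rewrite -Qp_of_cst -rmorphB.
apply: (@le_lt_trans _ _ (e / 2)); last by rewrite ltr_pdivrMr// ltr_pMr// ltr1n.
apply: padic_abs_le; first exact: ltW.
by exists N => n Nn; rewrite ltW//; apply: uN.
Qed.

Definition padic_dist x y := padic_abs (x - y).

Lemma padic_distxx x : padic_dist x x = 0.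
Proof. by rewrite /padic_dist subrr padic_abs0. Qed.

Lemma padic_dist_eq0 x y : padic_dist x y = 0 -> x = y.
Proof. by move/eqP; rewrite padic_abs_eq0 subr_eq0 => /eqP. Qed.

Lemma padic_dist_triangle y x z :
  padic_dist x z <= padic_dist x y + padic_dist y z.
Proof.
rewrite /padic_dist -[x in leLHS](subrK y) -addrA.
apply: le_trans (padic_absD _ _) _.
by rewrite ge_max lerDl lerDr !padic_abs_ge0.
Qed.

HB.instance Definition _ := isMetric.Build rat 'Q_[p]
  padic_distxx padic_dist_eq0 padic_distC padic_dist_triangle.

HB.instance Definition _ := isPointed.Build 'Q_[p] 0.

Lemma padic_ballE (x y : 'Q_[p]) e : ball x e y <-> padic_abs (x - y) < e.
Proof. by rewrite ballEmdist. Qed.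

Lemma inv_nat_lt (e : rat) : 0 < e ->
  exists N : nat, forall n, (N <= n)%N -> n.+1%:R^-1 < e.
Proof.
move=> e0; exists (Num.truncn e^-1).+1 => n Nn.
rewrite invf_plt ?posrE//; apply: lt_le_trans (truncnS_gt _) _.
by rewrite ler_nat ltnW.
Qed.

Lemma Qp_complete (F : set_system 'Q_[p]) :
  ProperFilter F -> cauchy F -> cvg F.
Proof.
move=> FF /cauchyP cF.
have /choice[r rP] (n : nat) : exists r : rat,
    F [set y : 'Q_[p] | padic_abs (ratr r - y) < n.+1%:R^-1].
  have en : 0 < n.+1%:R^-1 :> rat by rewrite invr_gt0.
  have [x Fx] := cF _ en; have [r xr] := ratr_dense x en.
  exists r; apply: filterS Fx => y /padic_ballE xy /=.
  rewrite (_ : ratr r - y = (x - y) - (x - ratr r)); last by ring.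
  apply: le_lt_trans (padic_absD _ _) _.
  by rewrite padic_absN gt_max xy xr.
have cr : padic_cauchy p r.
  move=> e e0; have [N Ne] := inv_nat_lt e0.
  exists N => m n Nm Nn; rewrite -padic_abs_ratr.
  have [y [/= ym yn]] := filter_ex (filterI (rP m) (rP n)).
  rewrite (_ : ratr (r m - r n) = (ratr (r m) - y) - (ratr (r n) - y)); last first.
    by rewrite -!Qp_of_cst !rmorphB /= ; ring.
  apply: le_lt_trans (padic_absD _ _) _.
  by rewrite padic_absN gt_max (lt_trans ym) ?Ne// (lt_trans yn) ?Ne.
pose u := CauchySeq (asboolT cr : _ \in cauchy_pred p).
apply: (cvgP (Qp_of u)); apply/cvg_ballP => e e0.
have e2 : 0 < e / 2 by rewrite divr_gt0.
have e2e : e / 2 < e by rewrite ltr_pdivrMr// ltr_pMr// ltr1n.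
have [N Ne] := inv_nat_lt e0; have [M rM] := cr _ e2.
have rF := rP (maxn M N); apply: filterS rF => y /= ry; apply/padic_ballE.
set k := maxn M N in ry *.
rewrite (_ : Qp_of u - y = (Qp_of u - ratr (r k)) + (ratr (r k) - y)); last by ring.
apply: le_lt_trans (padic_absD _ _) _; rewrite gt_max; apply/andP; split; last first.
  by apply: lt_trans ry _; rewrite Ne// leq_maxr.
apply: le_lt_trans e2e; rewrite -Qp_of_cst -rmorphB.
apply: padic_abs_le; first exact: ltW.
by exists M => n Mn; rewrite ltW// rM// leq_maxl.
Qed.

HB.instance Definition _ := Uniform_isComplete.Build 'Q_[p] Qp_complete.

End QpField.


Definition exp_p (p : nat) (x : 'Q_[p]) : 'Q_[p] :=
  limn (series (fun n : nat => x ^+ n / n`!%:R)).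

Definition ln_p (p : nat) (x : 'Q_[p]) : 'Q_[p] :=
  limn (series (fun n : nat => (-1) ^+ n * (x - 1) ^+ n.+1 / n.+1%:R)).

(* |x|_p < p^(-1/(p-1)), the disc of convergence of [exp_p]. The radius is in
   general irrational, hence the real numbers [R]. *)
Definition in_exp_disc (R : realType) (p : nat) (x : 'Q_[p]) : Prop :=
  ratr (padic_abs x) < p%:R `^ (- (p.-1%:R)^-1) :> R.

Definition Ep (R : realType) (p : nat) : set 'Q_[p] :=
  [set x | in_exp_disc R (x - 1)].

(* The vertex [:: i_n; ...; i_1] is reached from the root [::] by going to the
   child number i_1, then i_2, ..., then i_n. *)
Definition vertex (k : nat) : Type := seq 'I_k.

Definition is_child (k : nat) (x y : vertex k) : bool :=
  [exists i : 'I_k, y == i :: x].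

Definition tree_adj (k : nat) (x y : vertex k) : bool :=
  is_child x y || is_child y x.

Definition root_dist (k : nat) (x : vertex k) : nat := size x.

(* [root_dist] is the graph distance to the root. *)
Lemma root_dist_path (k : nat) (x : vertex k) :
  exists2 s : seq (vertex k), path (@tree_adj k) [::] s &
    last [::] s = x /\ size s = root_dist x.
Proof.
elim: x => [|i x [s ps [ls ss]]]; first by exists [::].
exists (rcons s (i :: x)); last by rewrite last_rcons size_rcons ss.
rewrite rcons_path ps ls /tree_adj /is_child; apply/orP; left.
by apply/existsP; exists i.
Qed.

Lemma root_dist_min (k : nat) (x : vertex k) (s : seq (vertex k)) :
  path (@tree_adj k) [::] s -> last [::] s = x -> (root_dist x <= size s)%N.
Proof.
rewrite -[size s]addn0 -[X in (_ + X)%N]/(@root_dist k [::]) => + <-.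
elim: s [::] => [|y s IH] a //= /andP[ay /IH] /leq_trans; apply.
rewrite addSnnS leq_add2l.
by case/orP: ay => /existsP[i /eqP->] //=; rewrite /root_dist /= leqW.
Qed.

(* The vertices of V_n are the sequences of size at most n, those of W_n the
   sequences of size n. *)
Definition ball_config (k q n : nat) : Type := {ffun n.-bseq 'I_k -> 'I_q}.
Definition sphere_config (k q n : nat) : Type := {ffun n.-tuple 'I_k -> 'I_q}.

Lemma sphere_vertexP (k n : nat) (x : n.+1.-bseq 'I_k) :
  ~~ (size x <= n)%N -> size x == n.+1.
Proof. by rewrite -ltnNge eqn_leq size_bseq => ->. Qed.

Definition split_vertex (k n : nat) (x : n.+1.-bseq 'I_k) :
    n.-bseq 'I_k + n.+1.-tuple 'I_k :=
  match boolP (size x <= n)%N with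
  | AltTrue xn => inl (Bseq xn)
  | AltFalse xn => inr (Tuple (sphere_vertexP xn))
  end.

Definition concat_config (k q n : nat) (s : ball_config k q n)
    (t : sphere_config k q n.+1) : ball_config k q n.+1 :=
  [ffun x => match split_vertex x with inl y => s y | inr y => t y end].

Definition restrict_config (k q n : nat) (w : vertex k -> 'I_q) :
    ball_config k q n :=
  [ffun x : n.-bseq 'I_k => w x].

Section Potts.
Variables (R : realType) (k q p : nat) (J : 'Q_[p]).

(* Each edge of L_n occurs once, as a pair (parent, child). *)
Definition hamiltonian (n : nat) (s : ball_config k q n) : 'Q_[p] :=
  J * \sum_(e : n.-bseq 'I_k * n.-bseq 'I_k | is_child e.1 e.2)
        (s e.1 == s e.2)%:R.

(* The spin value i + 1 of {1, ..., q} is represented by i : ['I_q]. *)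
Definition boundary_function : Type := vertex k -> 'rV['Q_[p]]_q.

Definition boltzmann_weight (h : boundary_function) (n : nat)
    (s : ball_config k q n) : 'Q_[p] :=
  exp_p (hamiltonian s + \sum_(x : n.-tuple 'I_k) h x 0 (s x)).

Definition partition_function (h : boundary_function) (n : nat) : 'Q_[p] :=
  \sum_(s : ball_config k q n) boltzmann_weight h s.

Definition finite_gibbs (h : boundary_function) (n : nat)
    (s : ball_config k q n) : 'Q_[p] :=
  (partition_function h n)^-1 * boltzmann_weight h s.

Definition compatible (h : boundary_function) : Prop :=
  forall (n : nat) (s : ball_config k q n),
    \sum_(t : sphere_config k q n.+1) finite_gibbs h (concat_config s t) =
    finite_gibbs h s.

Definition cylinder (n : nat) (s : ball_config k q n) : set (vertex k -> 'I_q) :=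
  [set w | restrict_config n w = s].

Definition cylinder_algebra : set (set (vertex k -> 'I_q)) :=
  [set A | exists n (B : set (ball_config k q n)),
     A = restrict_config n @^-1` B].

(* Only the values of [mu] on [cylinder_algebra] are relevant. *)
Definition finitely_additive (mu : set (vertex k -> 'I_q) -> 'Q_[p]) : Prop :=
  forall A B, cylinder_algebra A -> cylinder_algebra B -> A `&` B = set0 ->
    mu (A `|` B) = mu A + mu B.

Definition is_gibbs_measure (h : boundary_function)
    (mu : set (vertex k -> 'I_q) -> 'Q_[p]) : Prop :=
  [/\ forall x i, in_exp_disc R (h x 0 i),
      forall n, partition_function h n != 0,
      compatible h,
      finitely_additive mu &
      forall n (s : ball_config k q n), mu (cylinder s) = finite_gibbs h s].

Definition periodic_boundary (m : nat) (hh : 'I_m -> 'rV['Q_[p]]_q)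
    (h : boundary_function) : Prop :=
  forall (j : 'I_m) (x : vertex k),
    root_dist x = j %[mod m] -> h x = hh j.

Definition is_periodic_gibbs_measure (m : nat) (hh : 'I_m -> 'rV['Q_[p]]_q)
    (mu : set (vertex k -> 'I_q) -> 'Q_[p]) : Prop :=
  exists2 h, periodic_boundary hh h & is_gibbs_measure h mu.

End Potts.

(* With the convention [x / 0 = 0], G takes at its pole the value 0 if [0 < k];
   since 0 is not in [Ep R p], no cycle in [Ep R p] goes through the pole. *)
Definition potts_map (p : nat) (theta : 'Q_[p]) (a q k : nat) (z : 'Q_[p]) :
    'Q_[p] :=
  (((theta + a%:R - 1) * z + q%:R - a%:R) /
   (a%:R * z + theta + q%:R - a%:R - 1)) ^+ k.

(* [ordS] is the successor modulo m on ['I_m]. *)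
Definition is_cycle (T : Type) (G : T -> T) (m : nat) (z : 'I_m -> T) : Prop :=
  injective z /\ forall j : 'I_m, z j = G (z (ordS j)).

Definition indicator_vec (p n : nat) (A : {set 'I_n}) : 'rV['Q_[p]]_n :=
  \row_(i < n) (i \in A)%:R.

(* (ln (h z_1), ..., ln (h z_(q-1)), ln h) *)
Definition boundary_vec (p q : nat) (h : 'Q_[p]) (z : 'rV['Q_[p]]_q.-1) :
    'rV['Q_[p]]_q :=
  \row_(i < q) (if insub (i : nat) is Some i' then ln_p (h * z 0 i')
                else ln_p h).

(* Main.v *)
(* Put tau = theta - 1 and a = |alpha|; the hypotheses give
   |tau| < |q| < |a|.  The map under the cube is a Moebius map, and for
   |v - 1| = 1 its inverse sends v to the point
     1 + (v - 1) (q + tau) / (tau - a (v - 1)),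
   which is close to 1, and contracts by |q tau / a^2| < 1.  As p = 1 mod 3,
   cubing is an isometry from a neighbourhood of each of the two nontrivial
   cube roots of unity onto the disc E_p.  Composing, the Potts map has two
   contracting inverse branches g1, g2 from E_p to E_p with disjoint images, and
   the iterates of g1 from the fixed point of g2 o g1^(m-1) form an m-cycle.

   The cycle relation is the boundary law: summing out a sphere multiplies the
   Boltzmann weights by a nonzero constant, which gives compatibility and,
   by induction on the radius, the nonvanishing of the partition functions. *)

Require Import Defs.
From HB Require Import structures.
From mathcomp Require Import all_boot all_order all_algebra.
From mathcomp Require Import fingroup pgroup.
From mathcomp Require Import ring zify.
From mathcomp Require Import all_classical all_reals all_analysis.

Set Implicit Arguments.
Unset Strict Implicit.
Unset Printing Implicit Defensive.

Import Order.TTheory GRing.Theory Num.Theory.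

Local Open Scope ring_scope.

(** * p-adic absolute value *)

Section PadicAbs.
Variable p : nat.
Implicit Types (x y z : 'Q_[p]) (e : rat).

Lemma padic_abs_le_max x y e :
  padic_abs x <= e -> padic_abs y <= e -> padic_abs (x + y) <= e.
Proof. by move=> xe ye; rewrite (le_trans (padic_absD _ _))// ge_max xe. Qed.

Lemma padic_absB_le x y e :
  padic_abs x <= e -> padic_abs y <= e -> padic_abs (x - y) <= e.
Proof. by move=> xe ye; rewrite padic_abs_le_max ?padic_absN. Qed.

Lemma padic_absD_lt x y e :
  padic_abs x < e -> padic_abs y < e -> padic_abs (x + y) < e.
Proof. by move=> xe ye; rewrite (le_lt_trans (padic_absD _ _))// gt_max xe. Qed.

Lemma padic_absB_lt x y e :
  padic_abs x < e -> padic_abs y < e -> padic_abs (x - y) < e.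
Proof. by move=> xe ye; rewrite padic_absD_lt ?padic_absN. Qed.

Lemma padic_abs_sum_le (I : Type) (r : seq I) (P : pred I) (F : I -> 'Q_[p]) e :
  0 <= e -> (forall i, P i -> padic_abs (F i) <= e) ->
  padic_abs (\sum_(i <- r | P i) F i) <= e.
Proof.
move=> e0 Fe; apply: (big_ind (fun x => padic_abs x <= e)) => //.
- by rewrite padic_abs0.
- by move=> x y; exact: padic_abs_le_max.
Qed.

Lemma padic_abs_sum_lt (I : Type) (r : seq I) (P : pred I) (F : I -> 'Q_[p]) e :
  0 < e -> (forall i, P i -> padic_abs (F i) < e) ->
  padic_abs (\sum_(i <- r | P i) F i) < e.
Proof.
move=> e0 Fe; apply: (big_ind (fun x => padic_abs x < e)) => //.
- by rewrite padic_abs0.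
- by move=> x y; exact: padic_absD_lt.
Qed.

Lemma padic_absX x n : padic_abs (x ^+ n) = padic_abs x ^+ n.
Proof.
by elim: n => [|n IH]; rewrite ?expr0 ?padic_abs1// !exprS padic_absM IH.
Qed.

Lemma padic_absV x : padic_abs x^-1 = (padic_abs x)^-1.
Proof.
have [->|x0] := eqVneq x 0; first by rewrite invr0 padic_abs0 invr0.
apply: (mulfI (x := padic_abs x)); first by rewrite padic_abs_eq0.
by rewrite -padic_absM !divff ?padic_abs_eq0// padic_abs1.
Qed.

Lemma padic_abs_gt0 x : (0 < padic_abs x) = (x != 0).
Proof. by rewrite lt0r padic_abs_ge0 padic_abs_eq0 andbT. Qed.

Lemma padic_absDl x y : padic_abs y < padic_abs x ->
  padic_abs (x + y) = padic_abs x.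
Proof.
move=> yx; apply/eqP; rewrite eq_le padic_abs_le_max// ?(ltW yx)//=.
rewrite leNgt; apply/negP => xyx.
have := padic_absB_lt xyx yx; by rewrite addrK ltxx.
Qed.

Lemma padic_absDr x y : padic_abs x < padic_abs y ->
  padic_abs (x + y) = padic_abs y.
Proof. by rewrite addrC; exact: padic_absDl. Qed.

Hypothesis p_prime : prime p.

Lemma natp_gt1 : 1 < p%:R :> rat.
Proof. by rewrite ltr1n prime_gt1. Qed.

Lemma natp_gt0 : 0 < p%:R :> rat.
Proof. by rewrite ltr0n prime_gt0. Qed.

Lemma padic_abs_natE n : (0 < n)%N ->
  padic_abs (n%:R : 'Q_[p]) = p%:R ^- logn p n.
Proof.
move=> n0; rewrite padic_abs_nat /rat_padic_abs.
rewrite (_ : n%:R = (n : int)%:~R :> rat)// numq_int denq_int.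
by rewrite int_padic_abs1 divr1 /int_padic_abs eqz_nat gtn_eqF.
Qed.

Lemma padic_abs_nat_le1 n : padic_abs (n%:R : 'Q_[p]) <= 1.
Proof.
have [->|n0] := posnP n; first by rewrite padic_abs0.
by rewrite padic_abs_natE// invf_le1 ?exprn_gt0 ?natp_gt0// exprn_ege1// ltW// natp_gt1.
Qed.

Lemma padic_abs_natV_le n : (0 < n)%N -> (padic_abs (n%:R : 'Q_[p]))^-1 <= n%:R.
Proof.
move=> n0; rewrite padic_abs_natE// invrK -natrX ler_nat.
by rewrite dvdn_leq// pfactor_dvdnn.
Qed.

Lemma padic_abs_nat_dvd n : (padic_abs (n%:R : 'Q_[p]) < 1) = (p %| n)%N.
Proof.
have [->|n0] := posnP n; first by rewrite padic_abs0 ltr01 dvdn0.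
rewrite padic_abs_natE// invf_lt1 ?exprn_gt0 ?natp_gt0//.
rewrite -{1}(expr0 p%:R) ltr_eXn2l ?natp_gt1// logn_gt0 mem_primes.
by rewrite p_prime n0.
Qed.

(** The value group is generated by p: for rationals this is read off the valuations, and a nonzero
    [x] has the absolute value of any rational closer to it than 0 is. This later turns strict
    bounds into the contraction ratio 1/p. *)
Lemma padic_abs_disc x : padic_abs x < 1 -> padic_abs x <= p%:R^-1.
Proof.
have rlt (r : rat) : rat_padic_abs p r < 1 -> rat_padic_abs p r <= p%:R^-1.
  have p1 := natp_gt1; have p0 := natp_gt0.
  have [->|r0] := eqVneq r 0; first by rewrite rat_padic_abs0 invr_ge0 ltW.
  rewrite /rat_padic_abs /int_padic_abs numq_eq0 (negbTE r0) denq_eq0 /= invrK.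
  set m := logn p _; set n := logn p _.
  rewrite mulrC ltr_pdivrMr ?exprn_gt0// mul1r ltr_eXn2l// => nm.
  by rewrite ler_pdivrMr ?exprn_gt0// ler_pdivlMl// -exprS ler_eXn2l.
move=> x1; have [->|x0] := eqVneq x 0.
  by rewrite padic_abs0 invr_ge0 ltW// natp_gt0.
have := x0; rewrite -padic_abs_gt0 => ax0.
have [r xr] := ratr_dense x ax0.
have E : padic_abs x = padic_abs (ratr r : 'Q_[p]).
  rewrite -[X in _ = padic_abs X](subrK x) padic_absDr//.
  by rewrite padic_distC.
by rewrite E padic_abs_ratr in x1 *; exact: rlt.
Qed.

(** For p > 2 the radius p^(-1/(p-1)) lies strictly above 1/p and is at most 1, while no absolute
    value lies strictly between 1/p and 1. All estimates below can thus be made with the rational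
    bound |x| < 1. *)
Lemma in_exp_discE (R : realType) x : (2 < p)%N ->
  in_exp_disc R x <-> padic_abs x < 1.
Proof.
move=> p2; have p1 : 1 < p%:R :> R by rewrite ltr1n prime_gt1.
have p0 : 0 < p%:R :> R by rewrite (lt_trans ltr01).
rewrite /in_exp_disc; split=> [xd|/padic_abs_disc xp].
  rewrite -(ltr_rat R) rmorph1; apply: lt_le_trans xd _.
  rewrite -[leRHS](powRr0 p%:R); apply: ler_powR; first exact: ltW.
  by rewrite oppr_le0 invr_ge0 ler0n.
apply: (@le_lt_trans _ _ (p%:R^-1)).
  by move: xp; rewrite -(ler_rat R) fmorphV /= ratr_nat.
rewrite powRN ltf_pV2 ?posrE ?powR_gt0// -[ltRHS](lnK (x := p%:R)) ?posrE//.
rewrite /powR gt_eqF// ltr_expR gtr_pMl ?ln_gt0// invf_lt1 ?ltr1n ?ltr0n.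
  by rewrite ltn_predRL.
by lia.
Qed.
End PadicAbs.

(** * p-adic series *)

Section PadicSeries.
Variable p : nat.
Hypothesis p_prime : prime p.
Implicit Types (x y : 'Q_[p]) (a u : nat -> 'Q_[p]) (e : rat).

Lemma padic_limnP u l : (u n @[n --> \oo] --> l)%classic <->
  forall e, 0 < e ->
    exists N, forall n, (N <= n)%N -> padic_abs (l - u n) < e.
Proof.
split=> [/cvg_ballP ul e e0|ul]; last first.
  apply/cvg_ballP => e e0; have [N uN] := ul e e0.
  by exists N => // n Nn; apply/padic_ballE/uN.
by have [N _ uN] := ul e e0; exists N => n /uN /padic_ballE.
Qed.

Definition padic_vanishing a : Prop :=
  forall e, 0 < e -> exists N, forall n, (N <= n)%N -> padic_abs (a n) < e.

Lemma padic_series_sub_le a e N : 0 <= e ->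
  (forall n, (N <= n)%N -> padic_abs (a n) <= e) ->
  forall n, (N <= n)%N -> padic_abs (series a n - series a N) <= e.
Proof.
move=> e0 aN n Nn; rewrite sub_series_geq// big_nat_cond.
by apply: padic_abs_sum_le => // i /andP[/andP[Ni _] _]; exact: aN.
Qed.

Lemma padic_series_cvg a : padic_vanishing a -> cvgn (series a).
Proof.
move=> a0; apply: cauchy_cvg; apply: cauchy_exP => e e0.
have e2 : 0 < e / 2 by rewrite divr_gt0.
have [N aN] := a0 _ e2.
exists (series a N), N => // n Nn; apply/padic_ballE; rewrite padic_distC.
apply: (@le_lt_trans _ _ (e / 2)); last by rewrite ltr_pdivrMr// ltr_pMr// ltr1n.
by apply: padic_series_sub_le => //; [exact: ltW|move=> k /aN /ltW].
Qed.

(** In the ultrametric setting errors do not add up: a common bound for the terms from [N] on bounds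
    every finite tail, and a limit violating it would be contradicted by a partial sum close enough
    to that limit. *)
Lemma padic_series_tail a e N : padic_vanishing a -> 0 <= e ->
  (forall n, (N <= n)%N -> padic_abs (a n) <= e) ->
  padic_abs (limn (series a) - series a N) <= e.
Proof.
move=> a0 e0 aN; rewrite leNgt; apply/negP => elt.
have /padic_limnP la := padic_series_cvg a0.
have lt0 := le_lt_trans e0 elt.
have [M lM] := la _ lt0.
have := padic_series_sub_le e0 aN (leq_maxr M N).
have := lM _ (leq_maxl M N); set L := limn _ => lm nm.
have := padic_absD_lt lm (le_lt_trans nm elt).
by rewrite addrA subrK ltxx.
Qed.

(* For p > 2, [n`!] has valuation at most [n./2], so [half_radius n] bounds
   |x ^ n / n!| on the whole disc |x| <= 1/p. *)
Definition half_radius n : rat := p%:R ^- uphalf n.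

Lemma half_radius_gt0 n : 0 < half_radius n.
Proof. by rewrite invr_gt0 exprn_gt0// natp_gt0. Qed.

Lemma half_radius_le m n : (m <= n)%N -> half_radius n <= half_radius m.
Proof.
move=> mn; rewrite lef_pV2 ?posrE ?exprn_gt0 ?natp_gt0//.
by rewrite ler_eXn2l ?natp_gt1// uphalf_leq.
Qed.

Lemma half_radius_le1 n : half_radius n <= 1.
Proof. by rewrite (le_trans (half_radius_le (leq0n n)))// /half_radius invr1. Qed.

Lemma half_radius_lt e : 0 < e ->
  exists N, forall n, (N <= n)%N -> half_radius n < e.
Proof.
move=> e0; have [N Ne] := inv_nat_lt e0; exists N.*2 => n Nn.
have Nu : (N <= uphalf n)%N by lia.
apply: le_lt_trans (Ne _ Nu).
rewrite lef_pV2 ?posrE ?exprn_gt0 ?(natp_gt0 p_prime) ?ltr0n//.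
by rewrite -natrX ler_nat ltn_expl// prime_gt1.
Qed.

Lemma half_radius_vanishing a :
  (forall n, padic_abs (a n) <= half_radius n) -> padic_vanishing a.
Proof.
move=> ha e /half_radius_lt[N Ne]; exists N => n Nn.
exact: le_lt_trans (ha n) (Ne n Nn).
Qed.

(** Exact identities are obtained through this criterion, by estimating the difference of the two
    sides at every finite order [n]. *)
Lemma half_radius_eq0 x : (forall n, padic_abs x <= half_radius n) -> x = 0.
Proof.
move=> hx; apply/eqP; rewrite -padic_abs_eq0 eq_le padic_abs_ge0 andbT leNgt.
by apply/negP => /half_radius_lt[N /(_ N (leqnn N))]; rewrite ltNge hx.
Qed.

Lemma half_radiusM m n : half_radius m * half_radius n <= half_radius (m + n).
Proof.
rewrite /half_radius -invfM -exprD lef_pV2 ?posrE ?exprn_gt0 ?natp_gt0//.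
by rewrite ler_eXn2l ?natp_gt1//; lia.
Qed.
End PadicSeries.

(** * p-adic exponential *)

Section PadicExp.
Variable p : nat.
Hypotheses (p_prime : prime p) (p_gt2 : (2 < p)%N).
Implicit Types (x y : 'Q_[p]).
Local Notation w := (half_radius p).

Lemma logn_fact_le_half n : (logn p n`! <= n./2)%N.
Proof.
(* Legendre's sum is bounded by induction on the cut-off [m]. The extra term carries the induction:
   u = floor(n/p^m) and v = floor(u/p) satisfy 3v <= u because p >= 3. *)
have sum_le m : (2 * \sum_(1 <= k < m.+1) n %/ p ^ k + n %/ p ^ m <= n)%N.
  elim: m => [|m IH]; first by rewrite big_geq// expn0 divn1.
  rewrite big_nat_recr//= expnSr divnMA.
  have p3 : (n %/ p ^ m %/ p * 3 <= n %/ p ^ m)%N.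
    by rewrite (leq_trans _ (leq_trunc_div _ p))// leq_mul2l p_gt2 orbT.
  move: p3 IH; set S := bigop _ _ _.
  lia.
by rewrite logn_fact// geq_half_double -mul2n (leq_trans _ (sum_le n)) ?leq_addr.
Qed.

Definition exp_term x n : 'Q_[p] := x ^+ n / n`!%:R.

Lemma exp_term_le x n : padic_abs x < 1 -> padic_abs (exp_term x n) <= w n.
Proof.
move=> /(padic_abs_disc p_prime) xp.
rewrite padic_absM padic_absX padic_absV padic_abs_natE ?fact_gt0// invrK.
have p0 := natp_gt0 p_prime.
apply: (@le_trans _ _ (p%:R ^- n * p%:R ^+ n./2)); last first.
  have -> : p%:R ^+ n = p%:R ^+ uphalf n * p%:R ^+ n./2 :> rat.
    by rewrite -exprD uphalf_half -addnA addnn odd_double_half.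
  by rewrite invfM mulfVK// expf_neq0// gt_eqF.
apply: ler_pM; rewrite ?exprn_ge0 ?padic_abs_ge0 ?(ltW p0)//.
  by rewrite -exprVn lerXn2r ?nnegrE ?padic_abs_ge0// invr_ge0 ltW.
by rewrite ler_eXn2l ?natp_gt1// logn_fact_le_half.
Qed.

Lemma exp_term_vanishing x : padic_abs x < 1 -> padic_vanishing (exp_term x).
Proof. by move=> x1; apply: half_radius_vanishing => // n; exact: exp_term_le. Qed.

Lemma exp_tail x n : padic_abs x < 1 ->
  padic_abs (exp_p x - series (exp_term x) n) <= w n.
Proof.
move=> x1; apply: padic_series_tail; first exact: exp_term_vanishing.
  exact/ltW/half_radius_gt0.
by move=> m nm; rewrite (le_trans (exp_term_le m x1))// half_radius_le.
Qed.

Lemma exp_pB1 x : padic_abs x < 1 -> padic_abs (exp_p x - 1) < 1.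
Proof.
move=> x1; have := exp_tail 1 x1.
rewrite /series /= big_nat1 /exp_term expr0 fact0 divr1 => /le_lt_trans; apply.
by rewrite /half_radius expr1 invf_lt1 ?natp_gt0// natp_gt1.
Qed.

Lemma padic_abs_near1 x : padic_abs (x - 1) < 1 -> padic_abs x = 1.
Proof.
by move=> x1; rewrite -[x](subrK 1) padic_absDr padic_abs1.
Qed.

Lemma padic_abs_exp x : padic_abs x < 1 -> padic_abs (exp_p x) = 1.
Proof. by move=> /exp_pB1; exact: padic_abs_near1. Qed.

Lemma exp_p0 : exp_p (0 : 'Q_[p]) = 1.
Proof.
have a0 : padic_abs (0 : 'Q_[p]) < 1 by rewrite padic_abs0.
apply/eqP; rewrite -subr_eq0; apply/eqP/(half_radius_eq0 p_prime) => n.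
have := exp_tail n.+1 a0; rewrite /series /= big_nat_recl//=.
rewrite big1 => [|k _]; last by rewrite /exp_term expr0n mul0r.
rewrite /exp_term expr0 fact0 divr1 addr0 => /le_trans; apply.
exact: half_radius_le.
Qed.

Lemma expD_term x y n :
  exp_term (x + y) n = \sum_(i < n.+1) exp_term x i * exp_term y (n - i).
Proof.
rewrite /exp_term addrC exprDn mulr_suml; apply: eq_bigr => i _.
have iN : (i <= n)%N by rewrite -ltnS.
have := congr1 (fun k => k%:R : 'Q_[p]) (bin_fact iN); rewrite /= !natrM => <-.
have f0 k : (k`!%:R : 'Q_[p]) != 0 by rewrite Qp_natr_eq0 -lt0n fact_gt0.
have c0 : ('C(n, i)%:R : 'Q_[p]) != 0 by rewrite Qp_natr_eq0 -lt0n bin_gt0.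
have cancel_bin (F : fieldType) (u v c a b : F) : c != 0 -> a != 0 -> b != 0 ->
    u * v * c / (c * (a * b)) = v / a * (u / b) by move=> *; field; apply/and3P.
by rewrite -mulr_natr cancel_bin.
Qed.

(** Both sides run over the triangle i + j < n, by diagonals and by rows. *)
Lemma sum_antidiagonal (f : nat -> nat -> 'Q_[p]) n :
  \sum_(0 <= k < n) \sum_(i < k.+1) f i (k - i)%N =
  \sum_(0 <= i < n) \sum_(0 <= j < n - i) f i j.
Proof.
have widen k : (0 <= k < n)%N -> \sum_(i < k.+1) f i (k - i)%N =
    \sum_(0 <= i < n | (i < k.+1)%N) f i (k - i)%N.
  move=> kn; rewrite -(big_mkord xpredT (fun i => f i (k - i)%N)).
  by rewrite (big_nat_widen _ _ n).
rewrite (eq_big_nat _ _ widen).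
rewrite (exchange_big_dep_nat xpredT)//=; apply: eq_big_nat => i /andP[_ iN].
transitivity (\sum_(i <= k < n) f i (k - i)%N).
  by rewrite (big_nat_widenl i 0).
rewrite -{1}[i]add0n big_addn; apply: eq_bigr => k _.
by rewrite addnK.
Qed.

(** The partial sum for x + y runs over the triangle i + j < n, the product of the partial sums over
    the square i, j < n. The terms in between have i + j >= n, so they are at most [half_radius p n]
    by submultiplicativity, as are the tails of the three series. *)
Lemma exp_pD x y : padic_abs x < 1 -> padic_abs y < 1 ->
  exp_p (x + y) = exp_p x * exp_p y.
Proof.
move=> x1 y1; apply/eqP; rewrite -subr_eq0.
apply/eqP/(half_radius_eq0 p_prime) => n.
set Sx := series (exp_term x) n; set Sy := series (exp_term y) n.
set S := series (exp_term (x + y)) n.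
have xy1 := padic_absD_lt x1 y1.
have split_diff (A : comPzRingType) (e ex ey s sx sy : A) :
    e - ex * ey = (e - s) + ((s - sx * sy) - ((ex - sx) * ey + sx * (ey - sy))).
  by ring.
rewrite (split_diff _ _ _ _ S Sx Sy).
apply: padic_abs_le_max; first exact: exp_tail.
apply: padic_absB_le; last first.
  apply: padic_abs_le_max; rewrite padic_absM.
    by rewrite padic_abs_exp// mulr1 exp_tail.
  rewrite -[leRHS]mul1r ler_pM ?padic_abs_ge0 ?exp_tail//.
  apply: padic_abs_sum_le => // i _.
  by rewrite (le_trans (exp_term_le _ _)) ?half_radius_le1.
rewrite padic_distC /S /Sx /Sy /series /=.
under [X in _ - X]eq_bigr do rewrite expD_term.
rewrite (sum_antidiagonal (fun i j => exp_term x i * exp_term y j)).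
rewrite mulr_suml -sumrB.
have w0 := ltW (half_radius_gt0 p_prime n).
apply: padic_abs_sum_le => // i _; rewrite mulr_sumr.
rewrite (big_cat_nat (n := n - i)) ?leq_subr//= addrAC subrr add0r.
rewrite big_nat_cond; apply: padic_abs_sum_le => // j /andP[/andP[nij _] _].
rewrite padic_absM (le_trans (ler_pM _ _ (exp_term_le i x1) (exp_term_le j y1)))//.
- exact: padic_abs_ge0.
- exact: padic_abs_ge0.
- apply: le_trans (half_radiusM p_prime _ _) _.
  by apply: half_radius_le => //; rewrite -leq_subLR.
Qed.

Lemma exp_p_sum (I : Type) (r : seq I) (P : pred I) (F : I -> 'Q_[p]) :
  (forall i, P i -> padic_abs (F i) < 1) ->
  exp_p (\sum_(i <- r | P i) F i) = \prod_(i <- r | P i) exp_p (F i).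
Proof.
move=> F1; elim: r => [|i r IH]; first by rewrite !big_nil exp_p0.
rewrite !big_cons; case: ifP => // Pi.
by rewrite exp_pD ?F1// ?IH// padic_abs_sum_lt.
Qed.

Lemma exp_pMn x n : padic_abs x < 1 -> exp_p (x *+ n) = exp_p x ^+ n.
Proof.
by move=> x1; rewrite -[n]card_ord -sumr_const exp_p_sum// prodr_const.
Qed.

(** Every term of order k >= 2 carries the factor n^k, and |n|^k <= |n|^2. *)
Lemma exp_p_natM x n : padic_abs x < 1 ->
  padic_abs (exp_p (n%:R * x) - 1 - n%:R * x) <=
  padic_abs (n%:R : 'Q_[p]) ^+ 2.
Proof.
move=> x1; have n1 := padic_abs_nat_le1 p_prime n.
have nx1 : padic_abs (n%:R * x) < 1.
  by rewrite padic_absM (le_lt_trans _ x1)// ler_piMl// padic_abs_ge0.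
have := @padic_series_tail _ (exp_term (n%:R * x)) (padic_abs (n%:R : 'Q_[p]) ^+ 2) 2.
rewrite {2}/series /= big_nat_recr//= big_nat1 /exp_term expr0 expr1 !divr1.
rewrite opprD addrA; apply; first exact: exp_term_vanishing.
  by rewrite exprn_ge0// padic_abs_ge0.
move=> k k2; rewrite exprMn -mulrA padic_absM padic_absX -[leRHS]mulr1.
rewrite ler_pM ?exprn_ge0 ?padic_abs_ge0 ?ler_wiXn2l ?padic_abs_ge0//.
by rewrite (le_trans (exp_term_le _ x1))// half_radius_le1.
Qed.
End PadicExp.

(** * p-adic logarithm *)

Section PadicLog.
Variable p : nat.
Hypotheses (p_prime : prime p) (p_gt2 : (2 < p)%N).
Implicit Types (t y : 'Q_[p]).
Local Notation w := (half_radius p).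

Definition log_term t k : 'Q_[p] := (-1) ^+ k * t ^+ k.+1 / k.+1%:R.

Lemma padic_abs_sign k : padic_abs ((-1) ^+ k : 'Q_[p]) = 1.
Proof. by rewrite padic_absX padic_absN padic_abs1 expr1n. Qed.

(** Dividing by k + 1 enlarges the absolute value no more than dividing by (k + 1)!, so the estimate
    for the exponential series applies. *)
Lemma pow_div_le t k : padic_abs t < 1 ->
  padic_abs (t ^+ k.+1 / k.+1%:R) <= w k.+1.
Proof.
move=> t1; apply: le_trans (exp_term_le p_prime p_gt2 k.+1 t1).
rewrite !padic_absM !padic_absV ler_wpM2l ?padic_abs_ge0// factS natrM padic_absM.
have a0 n : (0 < n)%N -> 0 < padic_abs (n%:R : 'Q_[p]).
  by move=> n0; rewrite padic_abs_gt0 Qp_natr_eq0 -lt0n.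
rewrite lef_pV2 ?posrE ?mulr_gt0 ?a0 ?fact_gt0//.
by rewrite ler_piMr ?padic_abs_ge0// padic_abs_nat_le1.
Qed.

Lemma log_term_le t k : padic_abs t < 1 -> padic_abs (log_term t k) <= w k.+1.
Proof.
by move=> t1; rewrite /log_term -mulrA padic_absM padic_abs_sign mul1r pow_div_le.
Qed.

Lemma log_tail t n : padic_abs t < 1 ->
  padic_abs (ln_p (1 + t) - series (log_term t) n) <= w n.+1.
Proof.
move=> t1; rewrite /ln_p (addrC 1) addrK.
apply: padic_series_tail.
- apply: half_radius_vanishing => // k.
  by rewrite (le_trans (log_term_le k t1))// half_radius_le.
- exact/ltW/half_radius_gt0.
- by move=> k nk; rewrite (le_trans (log_term_le k t1))// half_radius_le.
Qed.

Lemma padic_abs_ln t : padic_abs t < 1 -> padic_abs (ln_p (1 + t)) < 1.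
Proof.
move=> /(log_tail 0); rewrite /series /= big_geq// subr0 => /le_lt_trans; apply.
by rewrite /half_radius expr1 invf_lt1 ?natp_gt0// natp_gt1.
Qed.

(** The identity (k + 1) C(n+1, k+1) = (n + 1) C(n, k) extracts the factor n + 1 from the binomial
    expansion and leaves the terms of the logarithm, up to the coefficients C(n, k) in place of
    signs. *)
Lemma pow1D_sub1 t n : (1 + t) ^+ n.+1 - 1 =
  n.+1%:R * \sum_(k < n.+1) 'C(n, k)%:R * (t ^+ k.+1 / k.+1%:R).
Proof.
rewrite exprDn big_ord_recl /= expr1n mul1r expr0 bin0 addrAC subrr add0r.
rewrite mulr_sumr; apply: eq_bigr => k _.
rewrite /bump /= add1n expr1n mul1r -mulr_natl mulrA -natrM mul_bin_diag natrM.
have cancel (F : fieldType) (a b c : F) : c != 0 -> b * a = c * b * (a / c).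
  by move=> c0; field.
by apply: cancel; rewrite Qp_natr_eq0.
Qed.

(** The first summand [t] dominates: relative to it, a later one has absolute value at most p^-(k+1)
    (k + 2), which is less than 1 since k + 2 < 3^(k+1) <= p^(k+1). *)
Lemma padic_abs_pow1D_sub1 t n : padic_abs t < 1 ->
  padic_abs ((1 + t) ^+ n.+1 - 1) = padic_abs (n.+1%:R : 'Q_[p]) * padic_abs t.
Proof.
move=> t1; have [->|t0] := eqVneq t 0.
  by rewrite addr0 expr1n subrr padic_abs0 mulr0.
rewrite pow1D_sub1 padic_absM big_ord_recl bin0 mul1r expr1 divr1.
rewrite padic_absDl// -[ltRHS]mulr1; have at0 : 0 < padic_abs t by rewrite padic_abs_gt0.
apply: padic_abs_sum_lt => [|k _]; first by rewrite mulr1.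
rewrite lift0 exprS -[t * _ / _]mulrA mulrCA padic_absM.
rewrite ltr_pM2l// padic_absM.
apply: (@le_lt_trans _ _ (padic_abs (t ^+ k.+1 / k.+2%:R))).
  by rewrite ler_piMl ?padic_abs_ge0// padic_abs_nat_le1.
rewrite padic_absM padic_absX padic_absV.
have p0 := natp_gt0 p_prime.
apply: (@le_lt_trans _ _ (p%:R ^- k.+1 * k.+2%:R)).
  rewrite ler_pM ?exprn_ge0 ?invr_ge0 ?padic_abs_ge0// ?padic_abs_natV_le//.
  by rewrite -exprVn lerXn2r ?nnegrE ?padic_abs_ge0 ?invr_ge0 ?(ltW p0)// padic_abs_disc.
rewrite ltr_pdivrMl ?exprn_gt0// mulr1 -natrX ltr_nat.
apply: (@leq_trans (3 ^ k.+1)); last by rewrite leq_exp2r.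
by elim: (k : nat) => // m IH; rewrite expnS; lia.
Qed.

(* Modulo [n.+1], [n] is [-1], and 'C(-1, k) = (-1) ^ k. *)
Lemma bin_sub_sign n k :
  padic_abs ('C(n, k)%:R - (-1) ^+ k : 'Q_[p]) <=
  padic_abs (n.+1%:R : 'Q_[p]) * k%:R.
Proof.
elim: k => [|k IH]; first by rewrite bin0 expr0 subrr padic_abs0 mulr0.
have -> : 'C(n, k.+1)%:R - (-1) ^+ k.+1 =
    'C(n.+1, k.+1)%:R - ('C(n, k)%:R - (-1) ^+ k) :> 'Q_[p].
  by rewrite binS natrD exprS mulN1r opprK opprB addrACA subrr addr0.
apply: padic_absB_le; last first.
  by rewrite (le_trans IH)// ler_wpM2l ?padic_abs_ge0// ler_nat.
have -> : 'C(n.+1, k.+1)%:R = n.+1%:R * 'C(n, k)%:R / k.+1%:R :> 'Q_[p].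
  by rewrite -natrM mul_bin_diag natrM mulrAC divff ?mul1r ?Qp_natr_eq0.
rewrite !padic_absM padic_absV -mulrA ler_wpM2l ?padic_abs_ge0//.
rewrite -[leRHS]mul1r ler_pM ?invr_ge0 ?padic_abs_ge0 ?padic_abs_nat_le1//.
exact: padic_abs_natV_le.
Qed.

(** Replacing C(n, k) by (-1)^k in [pow1D_sub1] gives n + 1 times the truncated logarithm. By
    [bin_sub_sign] this costs a second factor |n + 1| times k, and k is absorbed by the decay of
    t^(k+1)/(k+1). *)
Lemma pow1D_log n t : padic_abs t < 1 ->
  padic_abs ((1 + t) ^+ n.+1 - 1 - n.+1%:R * series (log_term t) n.+1) <=
  padic_abs (n.+1%:R : 'Q_[p]) ^+ 2.
Proof.
move=> t1; rewrite pow1D_sub1 /series /= big_mkord -mulrBr -sumrB padic_absM expr2.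
rewrite ler_wpM2l ?padic_abs_ge0//.
apply: padic_abs_sum_le => [|k _]; first exact: padic_abs_ge0.
rewrite /log_term -mulrA -mulrBl padic_absM.
apply: le_trans (ler_pM _ _ (bin_sub_sign n k) (pow_div_le k t1)) _.
- exact: padic_abs_ge0.
- exact: padic_abs_ge0.
rewrite -mulrA ler_piMr ?padic_abs_ge0// /half_radius.
have p0 := natp_gt0 p_prime.
rewrite ler_pdivrMr ?exprn_gt0// mul1r -natrX ler_nat.
have : (uphalf k.+1 < p ^ uphalf k.+1)%N by rewrite ltn_expl// prime_gt1.
have : (2 * uphalf k.+1 <= 3 ^ uphalf k.+1)%N.
  by elim: (uphalf _) => // m IH; rewrite expnS; lia.
have : (3 ^ uphalf k.+1 <= p ^ uphalf k.+1)%N by rewrite leq_exp2r.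
lia.
Qed.

Lemma pow1D_ln n t : padic_abs t < 1 ->
  padic_abs ((1 + t) ^+ (p ^ n) - 1 - (p ^ n)%:R * ln_p (1 + t)) <=
  padic_abs ((p ^ n)%:R : 'Q_[p]) * w n.
Proof.
move=> t1; have pn0 : (0 < p ^ n)%N by rewrite expn_gt0 prime_gt0.
have apn : padic_abs ((p ^ n)%:R : 'Q_[p]) <= w n.
  rewrite padic_abs_natE// pfactorK// lef_pV2 ?posrE ?exprn_gt0 ?natp_gt0//.
  by rewrite ler_eXn2l ?natp_gt1//; lia.
have npn : (n <= p ^ n)%N by rewrite ltnW// ltn_expl// prime_gt1.
have := pow1D_log (p ^ n).-1 t1; rewrite prednK// => le1.
have := log_tail (p ^ n) t1 => le2.
have split_diff (A : comPzRingType) (a m l s : A) :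
  a - m * l = (a - m * s) - m * (l - s) by ring.
rewrite (split_diff _ _ _ _ (series (log_term t) (p ^ n)%N)).
apply: padic_absB_le.
  by rewrite (le_trans le1)// expr2 ler_wpM2l ?padic_abs_ge0.
rewrite padic_absM ler_wpM2l ?padic_abs_ge0//.
by rewrite (le_trans le2)// half_radius_le// ltnW.
Qed.

(* For [N] a power of [p], both [exp_p (ln_p y) ^+ N] and [y ^+ N] equal
   [1 + N * ln_p y] up to [o(N)], while raising to the power [N] multiplies
   distances between elements close to 1 by exactly [padic_abs N]. *)
Lemma ln_pK y : padic_abs (y - 1) < 1 -> exp_p (ln_p y) = y.
Proof.
move=> y1; have [t1 yE] : padic_abs (y - 1) < 1 /\ y = 1 + (y - 1).
  by rewrite addrCA subrr addr0.
have ay := padic_abs_near1 y1.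
have y0 : y != 0 by rewrite -padic_abs_gt0 ay.
have L1 : padic_abs (ln_p y) < 1 by rewrite yE padic_abs_ln.
set e := exp_p (ln_p y); set s := e / y - 1.
have s1 : padic_abs s < 1.
  rewrite /s -(divff y0) -mulrBl padic_absM padic_absV ay invr1 mulr1.
  rewrite -[e](subrK 1) -addrA -[1 - y]opprB.
  by rewrite padic_absB_lt// exp_pB1.
have ey : e = y * (1 + s) by rewrite /s addrCA subrr addr0 mulrC divfK.
suff /eqP : s = 0 by rewrite subr_eq0 => /eqP /(congr1 ( *%R^~ y)); rewrite divfK// mul1r.
apply: (half_radius_eq0 p_prime) => n.
have pn0 : (0 < p ^ n)%N by rewrite expn_gt0 prime_gt0.
have apn0 : 0 < padic_abs ((p ^ n)%:R : 'Q_[p]).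
  by rewrite padic_abs_gt0 Qp_natr_eq0 -lt0n.
rewrite -(ler_pM2l apn0).
have := padic_abs_pow1D_sub1 (p ^ n).-1 s1; rewrite prednK// => <-.
have -> : (1 + s) ^+ (p ^ n) - 1 = (e ^+ (p ^ n) - y ^+ (p ^ n)) / y ^+ (p ^ n).
  by rewrite ey exprMn mulrBl mulrAC divff ?expf_neq0// mul1r.
rewrite padic_absM padic_absV padic_absX ay expr1n invr1 mulr1.
rewrite -(exp_pMn p_prime p_gt2)// -[_ *+ _]mulr_natl.
have split_diff (A : comPzRingType) (a b x : A) :
  a - b = (a - 1 - x) - (b - 1 - x) by ring.
rewrite (split_diff _ _ _ ((p ^ n)%:R * ln_p y)).
apply: padic_absB_le.
  apply: le_trans (exp_p_natM p_prime p_gt2 _ L1) _.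
  rewrite expr2 ler_wpM2l ?padic_abs_ge0//.
  rewrite padic_abs_natE// pfactorK// lef_pV2 ?posrE ?exprn_gt0 ?natp_gt0//.
  by rewrite ler_eXn2l ?natp_gt1//; lia.
rewrite {1 2}yE; exact: pow1D_ln.
Qed.
End PadicLog.

(** * Contractions and cube roots *)

Section Contraction.
Variable p : nat.
Hypothesis p_prime : prime p.
Implicit Types (x y c : 'Q_[p]) (f : 'Q_[p] -> 'Q_[p]).

(** Banach's fixed point theorem on a residue disc. The limit of the iterates of [f] from [c] is
    written as [c] plus the sum of their successive differences, so that the tail estimate for
    series gives the distance to each iterate. *)
Lemma padic_contraction f c :
  (forall x, padic_abs (x - c) < 1 -> padic_abs (f x - c) < 1) ->
  (forall x y, padic_abs (x - c) < 1 -> padic_abs (y - c) < 1 ->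
    padic_abs (f x - f y) <= p%:R^-1 * padic_abs (x - y)) ->
  exists2 x, padic_abs (x - c) < 1 & f x = x.
Proof.
move=> fE fC; pose u n := iter n f c; pose a n := u n.+1 - u n.
have p0 := natp_gt0 p_prime.
have pV0 : 0 < p%:R^-1 :> rat by rewrite invr_gt0.
have pV1 : p%:R^-1 < 1 :> rat by rewrite invf_lt1// natp_gt1.
have uE n : padic_abs (u n - c) < 1.
  by elim: n => [|n IH]; [rewrite subrr padic_abs0|exact: fE].
have a_le n : padic_abs (a n) <= p%:R^-1 ^+ n.
  elim: n => [|n IH].
    by rewrite /a expr0 ltW// [u 0%N]/= uE.
  by rewrite (le_trans (fC _ _ (uE n.+1) (uE n)))// exprS ler_pM2l.
have a_half n : padic_abs (a n) <= half_radius p n.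
  rewrite (le_trans (a_le n))// /half_radius -exprVn.
  by rewrite ler_wiXn2l ?(ltW pV0) ?(ltW pV1)// leq_uphalf_double; lia.
have a_van := half_radius_vanishing p_prime a_half.
have sE n : series a n = u n - c by rewrite /series /= telescope_sumr.
pose x := c + limn (series a).
have xu n : padic_abs (x - u n) <= half_radius p n.
  rewrite -[u n](subrK c) -sE [_ + c]addrC /x opprD addrACA subrr add0r.
  apply: padic_series_tail => //; first exact/ltW/half_radius_gt0.
  by move=> k nk; rewrite (le_trans (a_half k))// half_radius_le.
have xE : padic_abs (x - c) < 1.
  rewrite -[x](subrK (u 1%N)) -addrA padic_absD_lt// (le_lt_trans (xu 1%N))//.
exists x => //; apply/eqP; rewrite -subr_eq0.
apply/eqP/(half_radius_eq0 p_prime) => n.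
rewrite -[f x](subrK (u n.+1)) -addrA; apply: padic_abs_le_max.
  apply: le_trans (fC _ _ xE (uE n)) _.
  by rewrite -[leRHS]mul1r ler_pM ?padic_abs_ge0 ?xu ?(ltW pV0) ?(ltW pV1).
by rewrite padic_distC (le_trans (xu n.+1))// half_radius_le.
Qed.
End Contraction.

Section CubeRoot.
Variable p : nat.
Hypotheses (p_prime : prime p) (p_gt3 : (3 < p)%N).
Implicit Types (v w : 'Q_[p]).

Lemma padic_absM_near v0 v v' : padic_abs v0 = 1 ->
  padic_abs (v - v0) < 1 -> padic_abs (v' - v0) < 1 ->
  padic_abs (v * v' - v0 ^+ 2) < 1.
Proof.
move=> v01 vv0 v'v0.
have -> : v * v' - v0 ^+ 2 = (v - v0) * v' + v0 * (v' - v0).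
  by rewrite mulrBl mulrBr expr2 addrA subrK.
have v'1 : padic_abs v' = 1 by rewrite -[v'](subrK v0) padic_absDr v01.
by apply: padic_absD_lt; rewrite padic_absM ?v01 ?v'1 ?mul1r ?mulr1.
Qed.

Lemma padic_abs3 : padic_abs (3%:R : 'Q_[p]) = 1.
Proof.
apply/eqP; rewrite eq_le padic_abs_nat_le1// leNgt padic_abs_nat_dvd//.
by rewrite dvdn_prime2 // gtn_eqF.
Qed.

Lemma subrX3 (A : comPzRingType) (a b : A) :
  a ^+ 3 - b ^+ 3 = (a - b) * (a * a + a * b + b * b).
Proof. by ring. Qed.

(** The difference quotient of the cube reduces to the derivative 3 v0^2 on the residue disc of
    [v0]. This derivative is a unit, which yields both the isometry and the convergence of Newton's
    iteration. *)
Lemma cube_quotient_near v0 v v' : padic_abs v0 = 1 ->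
  padic_abs (v - v0) < 1 -> padic_abs (v' - v0) < 1 ->
  padic_abs (v * v + v * v' + v' * v' - 3%:R * v0 ^+ 2) < 1.
Proof.
move=> v01 h h'.
have split_sum (A : comPzRingType) (a b c d : A) :
  a + b + c - 3%:R * d = (a - d) + (b - d) + (c - d) by ring.
rewrite split_sum.
by apply: padic_absD_lt; [apply: padic_absD_lt|]; exact: padic_absM_near.
Qed.

Lemma cube_isometry v0 v v' : padic_abs v0 = 1 ->
  padic_abs (v - v0) < 1 -> padic_abs (v' - v0) < 1 ->
  padic_abs (v ^+ 3 - v' ^+ 3) = padic_abs (v - v').
Proof.
move=> v01 h h'; rewrite subrX3 padic_absM.
rewrite -[_ + _ + v' * v'](subrK (3%:R * v0 ^+ 2)).
have a3 : padic_abs (3%:R * v0 ^+ 2) = 1.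
  by rewrite padic_absM padic_absX v01 padic_abs3 mul1r expr1n.
by rewrite [X in _ * X]padic_absDr a3 ?mulr1// cube_quotient_near.
Qed.

(** Hensel's lemma by Newton's iteration with the slope frozen at d = 3 v0^2. The difference
    quotient of [f] is (d - (t^2 + t t' + t'^2)) / d, whose absolute value is less than 1, hence at
    most 1/p. *)
Lemma cube_root_exists v0 w : padic_abs v0 = 1 -> padic_abs (v0 ^+ 3 - w) < 1 ->
  exists2 v, padic_abs (v - v0) < 1 & v ^+ 3 = w.
Proof.
move=> v01 v0w; pose d := 3%:R * v0 ^+ 2.
have a3 : padic_abs d = 1.
  by rewrite padic_absM padic_absX v01 padic_abs3 mul1r expr1n.
have d0 : d != 0 by rewrite -padic_abs_gt0 a3.
pose f t := t - (t ^+ 3 - w) / d.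
have [||v vv0 fv] := @padic_contraction p p_prime f v0.
- move=> t tv0; rewrite /f addrAC padic_absB_lt// padic_absM padic_absV a3.
  rewrite invr1 mulr1 -[t ^+ 3](subrK (v0 ^+ 3)) -addrA padic_absD_lt//.
  by rewrite (cube_isometry v01) ?subrr ?padic_abs0.
- move=> t t' tv0 t'v0.
  have f_sub (F : fieldType) (s s' e y : F) : e != 0 ->
      s - (s ^+ 3 - y) / e - (s' - (s' ^+ 3 - y) / e) =
      - (s * s + s * s' + s' * s' - e) / e * (s - s') by move=> e0; field.
  rewrite /f f_sub// !padic_absM padic_absV a3 invr1 mulr1 padic_absN.
  by rewrite ler_wpM2r ?padic_abs_ge0// padic_abs_disc// cube_quotient_near.
exists v => //; move: fv; rewrite /f => /eqP.
rewrite -subr_eq0 addrAC subrr add0r oppr_eq0 mulf_eq0 invr_eq0 (negbTE d0) orbF.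
by rewrite subr_eq0 => /eqP.
Qed.
End CubeRoot.

(** The unit group modulo p has order p - 1, divisible by 3, so Cauchy's theorem gives an element of
    order 3. *)
Lemma exists_primitive_cube_root_mod (p : nat) : prime p -> p = 1 %[mod 3] ->
  exists v : nat, v ^ 3 = 1 %[mod p] /\ v != 1 %[mod p].
Proof.
move=> p_prime p1; have p_gt1 := prime_gt1 p_prime.
have d3 : (3 %| #|units_Zp p|)%N.
  by rewrite card_units_Zp ?prime_gt0// totient_prime// -subn1 -eqn_mod_dvd ?prime_gt0// p1.
have [x xG ox] := Cauchy (isT : prime 3) d3.
(* The arithmetic of ['Z_p] uses the modulus [(Zp_trunc p).+2], which is p because p > 1. *)
have modE a b : (a = b %[mod p]) <-> (a = b %[mod (Zp_trunc p).+2]).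
  by rewrite Zp_cast.
exists (val x : nat); split.
  apply/modE; have := unit_Zp_expg x 3; rewrite -{1}ox expg_order.
  by move=> /(congr1 (@nat_of_ord _)).
apply/negP => /eqP/modE x1.
have xone : x = 1%g.
  apply/val_inj/val_inj; rewrite -[LHS](modn_small (ltn_ord (val x))) x1.
  by rewrite modn_small.
by move: ox; rewrite xone order1.
Qed.

(** * Cycles of the Potts map *)

(** Along the iterates of [g1] the map G steps back by one, and from z = g2 (g1^(m-1) z) it jumps to
    the last point. By injectivity of [g1], a coincidence of two points reduces to a return of some
    positive iterate to z, which would put z in the images of both [g1] and [g2]. *)
Lemma two_branch_cycle (T : Type) (G g1 g2 : T -> T) (E : T -> Prop) (m : nat) z :
  (0 < m)%N ->
  (forall x, E x -> E (g1 x)) -> (forall x, E x -> E (g2 x)) ->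
  (forall x, E x -> G (g1 x) = x) -> (forall x, E x -> G (g2 x) = x) ->
  (forall x y, E x -> E y -> g1 x <> g2 y) ->
  E z -> g2 (iter m.-1 g1 z) = z ->
  is_cycle G (fun j : 'I_m => iter j g1 z).
Proof.
move=> m0 E1 E2 G1 G2 g12 Ez zfix.
have Ei n : E (iter n g1 z) by elim: n => // n IH; exact: E1.
have g1_inj n x y : E x -> E y -> iter n g1 x = iter n g1 y -> x = y.
  move=> Ex Ey; have Ek t k : E t -> E (iter k g1 t).
    by move=> Et; elim: k => // k IH; exact: E1.
  elim: n => // n IH /= gE; apply: IH.
  by rewrite -[LHS]G1 ?gE ?G1//; exact: Ek.
have no_return d : iter d.+1 g1 z <> z.
  by move=> /= gz; apply: (g12 (iter d g1 z) (iter m.-1 g1 z)); rewrite ?zfix.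
split=> [i j|j].
  wlog ij : i j / (i <= j)%N.
    move=> W; have [/W//|/ltnW/W ji] := leqP i j.
    by move=> /esym/ji.
  rewrite -(subnKC ij) iterD => /(g1_inj _ _ _ Ez (Ei _)).
  case d : (j - i)%N => [|d'] //= zE; last by case: (no_return d').
  by apply: val_inj; move/eqP: d; rewrite subn_eq0 => ji; apply/eqP; rewrite eqn_leq ij.
rewrite /=; have [jm|] := ltnP j.+1 m; first by rewrite modn_small//= G1.
have := ltn_ord j => jm mj; have jE : j.+1 = m by apply/eqP; rewrite eqn_leq jm.
rewrite jE modnn /= -{2}zfix G2//.
by have -> : m.-1 = j by exact: (esym (congr1 predn jE)).
Qed.

(** * Contracting inverse branches of the Potts map *)

Section InverseBranches.
Variables (p : nat) (theta : 'Q_[p]) (a q : nat).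
Hypotheses (p_prime : prime p) (p_mod3 : p = 1 %[mod 3]).
Local Notation tau := (theta - 1).
Local Notation A := (a%:R : 'Q_[p]).
Local Notation Q := (q%:R : 'Q_[p]).
Hypotheses (tau_neq0 : tau != 0) (tau_q : padic_abs tau < padic_abs Q)
  (q_a : padic_abs Q < padic_abs A).
Implicit Types (v w z : 'Q_[p]).

Definition branch v : 'Q_[p] := 1 + (v - 1) * (Q + tau) / (tau - A * (v - 1)).

Let a_gt0 : 0 < padic_abs A.
Proof. exact: le_lt_trans (padic_abs_ge0 _) q_a. Qed.

Let a_neq0 : A != 0.
Proof. by rewrite -padic_abs_gt0. Qed.

Let tau_a : padic_abs tau < padic_abs A := lt_trans tau_q q_a.

Lemma branch_den v : padic_abs (v - 1) = 1 ->
  padic_abs (tau - A * (v - 1)) = padic_abs A.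
Proof.
by move=> v1; rewrite padic_absDr ?padic_absN padic_absM v1 mulr1.
Qed.

Lemma branch_den_neq0 v : padic_abs (v - 1) = 1 -> tau - A * (v - 1) != 0.
Proof. by move=> v1; rewrite -padic_abs_gt0 branch_den. Qed.

Lemma padic_abs_qtau : padic_abs (Q + tau) = padic_abs Q.
Proof. by rewrite padic_absDl. Qed.

Lemma qtau_neq0 : Q + tau != 0.
Proof.
by rewrite -padic_abs_gt0 padic_abs_qtau (le_lt_trans (padic_abs_ge0 _) tau_q).
Qed.

Lemma q_div_a_lt1 : padic_abs Q / padic_abs A < 1.
Proof. by rewrite ltr_pdivrMr// mul1r. Qed.

Lemma branch_near1 v : padic_abs (v - 1) = 1 -> padic_abs (branch v - 1) < 1.
Proof.
move=> v1; rewrite /branch addrAC subrr add0r !padic_absM padic_absV.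
by rewrite branch_den// padic_abs_qtau v1 mul1r q_div_a_lt1.
Qed.

Lemma branch_denE v : padic_abs (v - 1) = 1 ->
  A * branch v + theta + Q - A - 1 = (Q + tau) * tau / (tau - A * (v - 1)).
Proof.
move=> /branch_den_neq0.
have id (F : fieldType) (x y b t : F) : (t - 1) - b * (x - 1) != 0 ->
    b * (1 + (x - 1) * (y + (t - 1)) / ((t - 1) - b * (x - 1))) + t + y - b - 1 =
    (y + (t - 1)) * (t - 1) / ((t - 1) - b * (x - 1)) by move=> d0; field.
exact: id.
Qed.

Lemma branch_den_potts v : padic_abs (v - 1) = 1 ->
  A * branch v + theta + Q - A - 1 != 0.
Proof.
move=> v1; rewrite branch_denE// mulf_neq0 ?invr_eq0 ?branch_den_neq0//.
by rewrite mulf_neq0 ?qtau_neq0.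
Qed.

Lemma branch_numE v : padic_abs (v - 1) = 1 ->
  (theta + A - 1) * branch v + Q - A =
  v * (A * branch v + theta + Q - A - 1).
Proof.
move=> /branch_den_neq0.
have id (F : fieldType) (x y b t : F) : (t - 1) - b * (x - 1) != 0 ->
    (t + b - 1) * (1 + (x - 1) * (y + (t - 1)) / ((t - 1) - b * (x - 1))) + y - b =
    x * (b * (1 + (x - 1) * (y + (t - 1)) / ((t - 1) - b * (x - 1))) + t + y - b - 1).
  by move=> d0; field.
exact: id.
Qed.

Lemma potts_map_branch v : padic_abs (v - 1) = 1 ->
  potts_map theta a q 3 (branch v) = v ^+ 3.
Proof.
by move=> v1; rewrite /potts_map branch_numE// mulfK// branch_den_potts.
Qed.

(** With [a] spins of weight z and q - a of weight 1, this quantity is, up to the factor h, the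
    partition function of the ball of radius 0. The numerator below is nonzero since |Q| < |A (v -
    1)|. *)
Lemma branch_partition_neq0 v : padic_abs (v - 1) = 1 ->
  A * branch v + (Q - A) != 0.
Proof.
move=> v1; have d0 := branch_den_neq0 v1.
have -> : A * branch v + (Q - A) = tau * (A * (v - 1) + Q) / (tau - A * (v - 1)).
  have id (F : fieldType) (x y b t : F) : (t - 1) - b * (x - 1) != 0 ->
      b * (1 + (x - 1) * (y + (t - 1)) / ((t - 1) - b * (x - 1))) + (y - b) =
      (t - 1) * (b * (x - 1) + y) / ((t - 1) - b * (x - 1)).
    by move=> ?; field.
  exact: id.
rewrite mulf_neq0 ?invr_eq0// mulf_neq0// -padic_abs_gt0 padic_absDl.
  by rewrite padic_absM v1 mulr1.
by rewrite padic_absM v1 mulr1.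
Qed.

Lemma branch_lipschitz v v' : padic_abs (v - 1) = 1 -> padic_abs (v' - 1) = 1 ->
  padic_abs (branch v - branch v') <= p%:R^-1 * padic_abs (v - v').
Proof.
move=> v1 v'1.
(* The factors are grouped so that the last bracket has absolute value 1. The ratio 1/p comes from
   Q/A, whose absolute value is less than 1; tau/A is merely bounded by 1. *)
have -> : branch v - branch v' = (Q / A) * (tau / A) * (v - v') *
    ((Q + tau) / Q * (A / (tau - A * (v - 1))) * (A / (tau - A * (v' - 1)))).
  have id (F : fieldType) (x x' y b t : F) : (t - 1) - b * (x - 1) != 0 ->
      (t - 1) - b * (x' - 1) != 0 -> b != 0 -> y != 0 ->
      1 + (x - 1) * (y + (t - 1)) / ((t - 1) - b * (x - 1)) -
      (1 + (x' - 1) * (y + (t - 1)) / ((t - 1) - b * (x' - 1))) =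
      y / b * ((t - 1) / b) * (x - x') * ((y + (t - 1)) / y *
        (b / ((t - 1) - b * (x - 1))) * (b / ((t - 1) - b * (x' - 1)))).
    by move=> *; field; apply/and4P.
  apply: id; rewrite ?branch_den_neq0//.
  by rewrite -padic_abs_gt0 (le_lt_trans (padic_abs_ge0 _) tau_q).
have q0 : padic_abs Q != 0 by rewrite gt_eqF// (le_lt_trans (padic_abs_ge0 _) tau_q).
rewrite !padic_absM !padic_absV !branch_den// padic_abs_qtau.
rewrite !divff ?(gt_eqF a_gt0)// !mulr1.
rewrite ler_wpM2r ?padic_abs_ge0// -[leRHS]mulr1
  ler_pM ?mulr_ge0 ?invr_ge0 ?padic_abs_ge0//.
  by rewrite -padic_absV -padic_absM padic_abs_disc// padic_absM padic_absV q_div_a_lt1.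
by rewrite ler_pdivrMr// mul1r ltW.
Qed.

Lemma prime_mod3_gt3 : (3 < p)%N.
Proof.
have := prime_gt1 p_prime; move: p_mod3.
by case: (p) => [|[|[|[|]]]].
Qed.

Section OneBranch.
Variable v0 : 'Q_[p].
Hypotheses (v0_unit : padic_abs v0 = 1) (v0_cube : padic_abs (v0 ^+ 3 - 1) < 1)
  (v0_neq1 : padic_abs (v0 - 1) = 1).

(** The cube root in the residue disc of [v0]; by [cube_rootP] the default 0 is not taken when |w -
    1| < 1. *)
Definition cube_root w : 'Q_[p] :=
  xget 0 [set v | padic_abs (v - v0) < 1 /\ v ^+ 3 = w]%classic.

Lemma cube_rootP w : padic_abs (w - 1) < 1 ->
  padic_abs (cube_root w - v0) < 1 /\ cube_root w ^+ 3 = w.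
Proof.
move=> w1; have vw : padic_abs (v0 ^+ 3 - w) < 1.
  rewrite -[v0 ^+ 3](subrK 1) -addrA padic_absD_lt//.
  by rewrite padic_distC.
have [v vv0 v3] := cube_root_exists p_prime prime_mod3_gt3 v0_unit vw.
by rewrite /cube_root; case: xgetP => [u _ //|/(_ v)[]].
Qed.

Lemma cube_root_sub1 w : padic_abs (w - 1) < 1 -> padic_abs (cube_root w - 1) = 1.
Proof.
move=> /cube_rootP[vv0 _].
by rewrite -[cube_root w](subrK v0) -addrA padic_absDr v0_neq1.
Qed.

Definition inverse_branch w := branch (cube_root w).

Lemma inverse_branch_near1 w : padic_abs (w - 1) < 1 ->
  padic_abs (inverse_branch w - 1) < 1.
Proof. by move=> w1; rewrite branch_near1// cube_root_sub1. Qed.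

Lemma inverse_branchK w : padic_abs (w - 1) < 1 ->
  potts_map theta a q 3 (inverse_branch w) = w.
Proof.
move=> w1; rewrite potts_map_branch ?cube_root_sub1//.
by have [] := cube_rootP w1.
Qed.

(** The cube root is an isometry, so the Lipschitz constant is that of [branch]. *)
Lemma inverse_branch_lipschitz w w' :
  padic_abs (w - 1) < 1 -> padic_abs (w' - 1) < 1 ->
  padic_abs (inverse_branch w - inverse_branch w') <=
  p%:R^-1 * padic_abs (w - w').
Proof.
move=> w1 w'1; apply: le_trans (branch_lipschitz _ _) _; rewrite ?cube_root_sub1//.
have [c1 c3] := cube_rootP w1; have [c1' c3'] := cube_rootP w'1.
by rewrite -(cube_isometry p_prime prime_mod3_gt3 v0_unit c1 c1') c3 c3'.
Qed.

Lemma inverse_branch_regular w : padic_abs (w - 1) < 1 ->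
  A * inverse_branch w + theta + Q - A - 1 != 0 /\
  A * inverse_branch w + (Q - A) != 0.
Proof.
by move=> w1; rewrite branch_den_potts ?branch_partition_neq0 ?cube_root_sub1.
Qed.
End OneBranch.

Lemma branch_inj v v' : padic_abs (v - 1) = 1 -> padic_abs (v' - 1) = 1 ->
  branch v = branch v' -> v = v'.
Proof.
move=> v1 v'1 vv'; apply: (mulIf (branch_den_potts v1)).
by rewrite -branch_numE// vv' branch_numE.
Qed.

Lemma padic_abs_nat_sub1 n : (0 < n)%N ->
  (padic_abs (n%:R - 1 : 'Q_[p]) < 1) = (n == 1 %[mod p]).
Proof.
by move=> n0; rewrite -[X in _ - X]/(1%:R) -natrB// padic_abs_nat_dvd// eqn_mod_dvd.
Qed.

Lemma exists_approximate_cube_roots : exists v1 v2 : 'Q_[p],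
  [/\ padic_abs v1 = 1, padic_abs (v1 ^+ 3 - 1) < 1 & padic_abs (v1 - 1) = 1] /\
  [/\ padic_abs v2 = 1, padic_abs (v2 ^+ 3 - 1) < 1, padic_abs (v2 - 1) = 1 &
      padic_abs (v1 - v2) = 1].
Proof.
have [n [n3 n1]] := exists_primitive_cube_root_mod p_prime p_mod3.
have n0 : (0 < n)%N.
  by case: n n3 {n1} => // /eqP; rewrite mod0n modn_small ?prime_gt1.
pose v := n%:R : 'Q_[p].
have v3 : padic_abs (v ^+ 3 - 1) < 1.
  by rewrite -natrX padic_abs_nat_sub1 ?expn_gt0 ?n0// n3.
have av : padic_abs v = 1.
  apply/eqP; rewrite -(pexpr_eq1 (n := 3)) ?padic_abs_ge0//.
  by rewrite -padic_absX padic_abs_near1.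
have v1 : padic_abs (v - 1) = 1.
  apply/eqP; rewrite eq_le padic_absB_le ?padic_abs1 ?av//=.
  by rewrite leNgt padic_abs_nat_sub1.
have v1' : padic_abs (1 - v) = 1 by rewrite padic_distC.
exists v, (v ^+ 2); split; split=> //; rewrite ?padic_absX ?av ?expr1n//.
- rewrite exprAC expr2 -[X in _ - X](expr1n _ 2).
  by rewrite padic_absM_near// padic_abs1.
(* As v is a unit, |v^2 - 1| = |v^3 - v|, and v^3 - v differs from the unit 1 - v by the small v^3 -
   1. *)
- rewrite -[LHS]mul1r -{1}av -padic_absM mulrBr mulr1 -exprS.
  by rewrite -[v ^+ 3](subrK 1) -addrA padic_absDr v1'.
- by rewrite expr2 -{1}[v]mulr1 -mulrBr padic_absM av v1' mulr1.
Qed.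

Lemma potts_cycle_exists m : (0 < m)%N -> exists z : 'I_m -> 'Q_[p],
  [/\ forall j, padic_abs (z j - 1) < 1, is_cycle (potts_map theta a q 3) z,
      forall j, A * z j + theta + Q - A - 1 != 0 &
      forall j, A * z j + (Q - A) != 0].
Proof.
move=> m0; have [v1 [v2 [[v1u v1c v11] [v2u v2c v21 v12]]]] := exists_approximate_cube_roots.
pose g1 := inverse_branch v1; pose g2 := inverse_branch v2.
have E1 w : padic_abs (w - 1) < 1 -> padic_abs (g1 w - 1) < 1.
  exact: inverse_branch_near1.
have E2 w : padic_abs (w - 1) < 1 -> padic_abs (g2 w - 1) < 1.
  exact: inverse_branch_near1.
have Ei k w : padic_abs (w - 1) < 1 -> padic_abs (iter k g1 w - 1) < 1.
  by move=> w1; elim: k => // k IH; exact: E1.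
have pV1 : p%:R^-1 <= 1 :> rat by rewrite invf_le1 ?natp_gt0// ltW// natp_gt1.
(* Non-expansion of the iterates of [g1] suffices: the outer [g2] supplies the ratio 1/p, also for m
   = 1, where no [g1] is applied. *)
have iter_le k w w' : padic_abs (w - 1) < 1 -> padic_abs (w' - 1) < 1 ->
    padic_abs (iter k g1 w - iter k g1 w') <= padic_abs (w - w').
  move=> w1 w'1; elim: k => //= k IH.
  have lip := inverse_branch_lipschitz v1u v1c v11 (Ei k _ w1) (Ei k _ w'1).
  by apply: le_trans lip _; rewrite (le_trans _ IH)// ler_piMl// padic_abs_ge0.
have [||z z1 zfix] := @padic_contraction p p_prime (g2 \o iter m.-1 g1) 1.
- by move=> w w1; exact/E2/Ei.
- move=> w w' w1 w'1 /=.
  have lip := inverse_branch_lipschitz v2u v2c v21 (Ei m.-1 _ w1) (Ei m.-1 _ w'1).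
  apply: le_trans lip _.
  by rewrite ler_wpM2l ?iter_le// invr_ge0 ltW// natp_gt0.
(* Regularity holds on the images of the inverse branches. For k = 0 the point is z itself, which
   lies in the image of [g2] by the fixed point equation. *)
have reg k : A * iter k g1 z + theta + Q - A - 1 != 0 /\
    A * iter k g1 z + (Q - A) != 0.
  case: k => [|k]; last exact/inverse_branch_regular/Ei.
  by rewrite -zfix; exact/inverse_branch_regular/Ei.
exists (fun j => iter j g1 z); split=> [j||j|j];
  [exact: Ei| |exact: (reg j).1|exact: (reg j).2].
apply: (@two_branch_cycle _ _ g1 g2 (fun w => padic_abs (w - 1) < 1)) => //.
- by move=> w w1; exact: inverse_branchK.
- by move=> w w1; exact: inverse_branchK.
(* A common value of [g1] and [g2] would force a common cube root, close to both [v1] and [v2],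
   which are at distance 1. *)
move=> x y x1 y1 /branch_inj xy.
have [c1 _] := cube_rootP v1u v1c x1; have [c2 _] := cube_rootP v2u v2c y1.
have := padic_absB_lt c1 c2.
rewrite xy ?(cube_root_sub1 _ _ v11) ?(cube_root_sub1 _ _ v21)//.
by rewrite opprB addrC addrA subrK padic_distC v12 ltxx.
Qed.
End InverseBranches.

(** * Configurations on the tree *)

Section TreeConfigurations.
Variables (k q : nat).

Definition widen_vertex n (x : n.-bseq 'I_k) : n.+1.-bseq 'I_k :=
  widen_bseq (leqnSn n) x.

(** The match in [split_vertex] uses the proof carried by [boolP] inside its branches. With an
    arbitrary index [c] and witness [h], case analysis on it is well typed. *)
Lemma alt_spec_ind_match (P : Prop) (b c : bool) (T : Type) (f : P -> T)
    (g : ~~ b -> T) (Q : T -> Prop) (h : alt_spec P b c) :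
  (forall u, Q (f u)) -> (forall u, Q (g u)) ->
  Q (match h with AltTrue u => f u | AltFalse u => g u end).
Proof. by case: h. Qed.

Lemma split_widen_vertex n (x : n.-bseq 'I_k) : split_vertex (widen_vertex x) = inl x.
Proof.
apply: (alt_spec_ind_match (Q := fun v => v = inl x)) => h.
  by congr inl; exact: val_inj.
by case/negP: h; rewrite size_widen_bseq size_bseq.
Qed.

Lemma split_tuple_vertex n (t : n.+1.-tuple 'I_k) :
  split_vertex (bseq_of_tuple t) = inr t.
Proof.
apply: (alt_spec_ind_match (Q := fun v => v = inr t)) => h; last first.
  by congr inr; exact: val_inj.
by exfalso; move: h; rewrite /= size_tuple ltnn.
Qed.

Lemma split_vertexP n (x : n.+1.-bseq 'I_k) :
  match split_vertex x with
  | inl y => x = widen_vertex y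
  | inr t => x = bseq_of_tuple t
  end.
Proof.
by apply: (alt_spec_ind_match (Q := fun v => match v with
  | inl y => x = widen_vertex y | inr t => x = bseq_of_tuple t end)) => h;
  exact: val_inj.
Qed.

Lemma concat_configE (n : nat) (s : ball_config k q n) (t : sphere_config k q n.+1) :
  (forall x, concat_config s t (widen_vertex x) = s x) /\
  (forall x, concat_config s t (bseq_of_tuple x) = t x).
Proof.
by split=> x; rewrite ffunE ?split_widen_vertex ?split_tuple_vertex.
Qed.

Lemma big_vertexS (R : Type) (idx : R) (op : Monoid.com_law idx) n
    (F : n.+1.-bseq 'I_k -> R) :
  \big[op/idx]_x F x =
  op (\big[op/idx]_(x : n.-bseq 'I_k) F (widen_vertex x))
     (\big[op/idx]_(t : n.+1.-tuple 'I_k) F (bseq_of_tuple t)).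
Proof.
pose join (u : n.-bseq 'I_k + n.+1.-tuple 'I_k) : n.+1.-bseq 'I_k :=
  match u with inl y => widen_vertex y | inr t => bseq_of_tuple t end.
rewrite (reindex join); last first.
  exists (@split_vertex k n) => [[x|t] _|x _] /=.
  - by rewrite split_widen_vertex.
  - by rewrite split_tuple_vertex.
  - by rewrite /join; have := split_vertexP x; case: split_vertex.
by rewrite big_sumType.
Qed.

Definition restrict_ball n (s : ball_config k q n.+1) : ball_config k q n :=
  [ffun x => s (widen_vertex x)].

Definition restrict_sphere n (s : ball_config k q n.+1) : sphere_config k q n.+1 :=
  [ffun x => s (bseq_of_tuple x)].

Lemma concat_restrict n (s : ball_config k q n.+1) :
  concat_config (restrict_ball s) (restrict_sphere s) = s.
Proof.
apply/ffunP => x; rewrite ffunE; have := split_vertexP x.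
by case: split_vertex => y ->; rewrite ffunE.
Qed.

Lemma restrict_ball_concat n (s : ball_config k q n) (t : sphere_config k q n.+1) :
  restrict_ball (concat_config s t) = s.
Proof. by apply/ffunP => x; rewrite ffunE (concat_configE s t).1. Qed.

Lemma restrict_sphere_concat n (s : ball_config k q n) (t : sphere_config k q n.+1) :
  restrict_sphere (concat_config s t) = t.
Proof. by apply/ffunP => x; rewrite ffunE (concat_configE s t).2. Qed.

Lemma restrict_configS n (w : vertex k -> 'I_q) :
  restrict_ball (restrict_config n.+1 w) = restrict_config n w.
Proof. by apply/ffunP => x; rewrite !ffunE. Qed.

Lemma sum_ball_configS (V : nmodType) n (P : pred (ball_config k q n))
    (F : ball_config k q n.+1 -> V) :
  \sum_(s | P (restrict_ball s)) F s =
  \sum_(s | P s) \sum_(t : sphere_config k q n.+1) F (concat_config s t).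
Proof.
rewrite pair_big_dep /= (reindex (fun u => concat_config u.1 u.2)).
  by apply: eq_bigl => -[s t] /=; rewrite restrict_ball_concat andbT.
exists (fun s => (restrict_ball s, restrict_sphere s)) => [[s t] _|s _] /=.
  by rewrite restrict_ball_concat restrict_sphere_concat.
exact: concat_restrict.
Qed.

Definition child n (u : 'I_k * n.-tuple 'I_k) : n.+1.-tuple 'I_k :=
  [tuple of u.1 :: u.2].

Lemma big_child (R : Type) (idx : R) (op : Monoid.com_law idx) n
    (F : n.+1.-tuple 'I_k -> R) :
  \big[op/idx]_t F t =
  \big[op/idx]_(y : n.-tuple 'I_k) \big[op/idx]_(i : 'I_k) F (child (i, y)).
Proof.
rewrite exchange_big pair_big /= (reindex (@child n)).
  by apply: eq_bigr => -[i y].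
exists (fun t => (thead t, [tuple of behead t])) => [[i y] _|t _].
  by congr pair; exact: val_inj.
by rewrite /child /=; case/tupleP: t => i y; exact: val_inj.
Qed.

Lemma is_child_cons (x : vertex k) (i : 'I_k) (y : vertex k) :
  is_child x (i :: y) = (x == y).
Proof.
apply/existsP/eqP => [[j /eqP[_ ->]]//|->].
by exists i; rewrite eqxx.
Qed.

Lemma is_child_size (x y : vertex k) : is_child x y -> size y = (size x).+1.
Proof. by case/existsP => i /eqP ->. Qed.
End TreeConfigurations.

(** * Boundary laws *)

Section BoltzmannWeights.
Variables (k q p : nat) (J : 'Q_[p]) (h : boundary_function k q p).
Hypotheses (p_prime : prime p) (p_gt2 : (2 < p)%N) (J1 : padic_abs J < 1)
  (h1 : forall x i, padic_abs (h x 0 i) < 1).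

(** A vertex lists its steps from the last one back, so the parent is the tail of the list. *)
Definition parent n (u : n.+1.-tuple 'I_k) : n.-bseq 'I_k :=
  bseq_of_tuple [tuple of behead u].

(** The edges added in passing from radius n to n + 1 are exactly those joining each vertex of the
    new sphere to its parent. *)
Lemma hamiltonian_concat n (s : ball_config k q n) (t : sphere_config k q n.+1) :
  hamiltonian J (concat_config s t) =
  hamiltonian J s + J * \sum_(u : n.+1.-tuple 'I_k) (s (parent u) == t u)%:R.
Proof.
rewrite /hamiltonian -mulrDr; congr (J * _).
have [cb cs] := concat_configE s t.
pose d m (c : ball_config k q m) (x y : m.-bseq 'I_k) := (c x == c y)%:R : 'Q_[p].
rewrite -(pair_big_dep xpredT (fun x y : n.+1.-bseq 'I_k => is_child x y) (d _ _)).
rewrite -(pair_big_dep xpredT (fun x y : n.-bseq 'I_k => is_child x y) (d _ _)) /=.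
(* A vertex of the outer sphere has no child inside the ball. *)
rewrite big_vertexS /= [X in _ + X]big1 ?addr0 => [|x _]; last first.
  rewrite big_pred0// => y; apply/negbTE/negP => /is_child_size.
  by rewrite /= size_tuple => yx; have := size_bseq y; rewrite yx ltnn.
have split_children (x : n.-bseq 'I_k) :
    \sum_(y : n.+1.-bseq 'I_k | is_child (widen_vertex x) y)
      d _ (concat_config s t) (widen_vertex x) y =
    \sum_(y : n.-bseq 'I_k | is_child x y) d _ s x y +
    \sum_(u : n.+1.-tuple 'I_k | is_child x u) (s x == t u)%:R.
  rewrite big_mkcond big_vertexS [in RHS]big_mkcond [X in _ = _ + X]big_mkcond /=.
  by congr (_ + _); apply: eq_bigr => y _; rewrite /d cb ?cb ?cs.
rewrite (eq_bigr _ (fun x _ => split_children x)) big_split; congr (_ + _).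
(* After the exchange the inner sum runs over the [x] having the sphere vertex [u] as child, that is
   over its parent alone. *)
rewrite (exchange_big_dep xpredT)//=; apply: eq_bigr => u _.
rewrite (big_pred1 (parent u))// => x.
by case/tupleP: u => i y /=; rewrite is_child_cons.
Qed.

Definition spin_weight (x : vertex k) (b : 'I_q) : 'Q_[p] := exp_p (h x 0 b).

Definition edge_weight (a b : 'I_q) : 'Q_[p] := exp_p (J * (a == b)%:R).

Lemma edge_disc (a b : 'I_q) : padic_abs (J * (a == b)%:R) < 1.
Proof. by case: eqP; rewrite ?mulr1 ?mulr0 ?padic_abs0. Qed.

Lemma hamiltonian_disc n (s : ball_config k q n) : padic_abs (hamiltonian J s) < 1.
Proof.
rewrite /hamiltonian mulr_sumr; apply: padic_abs_sum_lt => // e _.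
exact: edge_disc.
Qed.

Lemma boltzmann_weightE n (s : ball_config k q n) :
  boltzmann_weight J h s =
  exp_p (hamiltonian J s) * \prod_(x : n.-tuple 'I_k) spin_weight x (s x).
Proof.
rewrite /boltzmann_weight exp_pD ?hamiltonian_disc ?padic_abs_sum_lt//.
by rewrite exp_p_sum.
Qed.

Lemma boltzmann_weight_concat n (s : ball_config k q n) (t : sphere_config k q n.+1) :
  boltzmann_weight J h (concat_config s t) =
  exp_p (hamiltonian J s) *
  \prod_(u : n.+1.-tuple 'I_k) (edge_weight (s (parent u)) (t u) * spin_weight u (t u)).
Proof.
rewrite boltzmann_weightE hamiltonian_concat mulr_sumr.
rewrite exp_pD ?hamiltonian_disc//; last first.
  by apply: padic_abs_sum_lt => // u _; exact: edge_disc.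
rewrite exp_p_sum//; last by move=> u _; exact: edge_disc.
rewrite -mulrA -big_split /=; congr (_ * _); apply: eq_bigr => u _.
by rewrite (concat_configE s t).2.
Qed.

(** Each spin of the outer sphere interacts only with its parent, so the sum over sphere
    configurations factorises over the sphere; the factors are then grouped by parent. *)
Lemma sum_boltzmann_weight_concat n (s : ball_config k q n) :
  \sum_(t : sphere_config k q n.+1) boltzmann_weight J h (concat_config s t) =
  exp_p (hamiltonian J s) * \prod_(y : n.-tuple 'I_k) \prod_(i < k)
    \sum_(b < q) edge_weight (s y) b * spin_weight (i :: y) b.
Proof.
under eq_bigr do rewrite boltzmann_weight_concat.
rewrite -mulr_sumr; congr (_ * _).
rewrite -(bigA_distr_bigA
  (fun u b => edge_weight (s (parent u)) b * spin_weight (tval u) b)).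
rewrite big_child; apply: eq_bigr => y _; apply: eq_bigr => i _.
by rewrite (_ : parent _ = bseq_of_tuple y)//; exact: val_inj.
Qed.

Variable c : vertex k -> 'Q_[p].
Hypotheses (c_neq0 : forall y, c y != 0)
  (boundary_law : forall y a,
    \prod_(i < k) \sum_(b < q) edge_weight a b * spin_weight (i :: y) b =
    c y * spin_weight y a)
  (root_neq0 : \sum_(b < q) spin_weight [::] b != 0).

(** By [boundary_law], summing out the children of y restores the weight at y up to c y. This
    constant does not depend on the spins, so it leaves the sum. *)
Lemma sum_boltzmann_weight n (s : ball_config k q n) :
  \sum_(t : sphere_config k q n.+1) boltzmann_weight J h (concat_config s t) =
  (\prod_(y : n.-tuple 'I_k) c y) * boltzmann_weight J h s.
Proof.
rewrite sum_boltzmann_weight_concat boltzmann_weightE mulrCA; congr (_ * _).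
rewrite -big_split; apply: eq_bigr => y _; exact: boundary_law.
Qed.

Lemma partition_functionS n : partition_function J h n.+1 =
  (\prod_(y : n.-tuple 'I_k) c y) * partition_function J h n.
Proof.
rewrite /partition_function (sum_ball_configS xpredT) mulr_sumr.
by apply: eq_bigr => s _; exact: sum_boltzmann_weight.
Qed.

Lemma partition_function0 :
  partition_function J h 0 = \sum_(b < q) spin_weight [::] b.
Proof.
have ball0 (x : 0.-bseq 'I_k) : x = [bseq] by exact: bseq0.
rewrite /partition_function (reindex (fun b : 'I_q => [ffun=> b] : ball_config k q 0)).
  apply: eq_bigr => b _; rewrite boltzmann_weightE.
  rewrite /hamiltonian big_pred0 => [|[x y]]; last first.
    by apply/negbTE/negP => /is_child_size /=; rewrite (ball0 x) (ball0 y).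
  rewrite mulr0 exp_p0// mul1r (big_pred1 [tuple]) => [|x].
    by rewrite ffunE.
  by rewrite /= tuple0; apply/esym/eqP.
exists (fun s : ball_config k q 0 => s [bseq]) => [b _|s _].
  by rewrite ffunE.
by apply/ffunP => x; rewrite ffunE (ball0 x).
Qed.

Lemma partition_function_neq0 n : partition_function J h n != 0.
Proof.
elim: n => [|n IH]; first by rewrite partition_function0.
by rewrite partition_functionS mulf_neq0//; exact/prodf_neq0.
Qed.

(** The factor gained by summing out the sphere is the one by which the partition function grows, so
    the two cancel. *)
Lemma boundary_law_compatible : compatible J h.
Proof.
move=> n s; rewrite /finite_gibbs -mulr_sumr sum_boltzmann_weight.
rewrite partition_functionS invfM mulrACA mulVf ?mul1r//.
exact/prodf_neq0.
Qed.
End BoltzmannWeights.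

(** * The Gibbs measure *)

Section GibbsMeasure.
Variables (k q p : nat) (J : 'Q_[p]) (h : boundary_function k q p).
Hypothesis comp : compatible J h.
Local Open Scope classical_set_scope.
Implicit Types (A B : set (vertex k -> 'I_q)).

(** Vertices outside the ball receive the spin of the root, through the default value of
    [insub_bseq]. The choice of extension does not affect membership in a set of
    [cylinder_level n]. *)
Definition extend_config n (s : ball_config k q n) (x : vertex k) : 'I_q :=
  s (insub_bseq n x).

Lemma extend_configK n (s : ball_config k q n) :
  restrict_config n (extend_config s) = s.
Proof. by apply/ffunP => x; rewrite ffunE /extend_config /insub_bseq valKd. Qed.

Definition cylinder_level n : set (set (vertex k -> 'I_q)) :=
  [set A | exists B : set (ball_config k q n), A = restrict_config n @^-1` B].

Definition ball_measure n A : 'Q_[p] :=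
  \sum_(s : ball_config k q n | `[< A (extend_config s) >]) finite_gibbs J h s.

Lemma cylinder_levelS n A : cylinder_level n A -> cylinder_level n.+1 A.
Proof.
move=> [B ->]; exists [set s | B (restrict_ball s)].
by apply/seteqP; split=> w /=; rewrite restrict_configS.
Qed.

(** Compatibility says that the weight of a configuration is the sum of the weights of its one-step
    extensions, so a set has the same measure at every level where it is a cylinder set. *)
Lemma ball_measureS n A : cylinder_level n A ->
  ball_measure n.+1 A = ball_measure n A.
Proof.
move=> [B ->]; rewrite /ball_measure.
under [RHS]eq_bigl do rewrite /= extend_configK.
under [RHS]eq_bigr do rewrite -comp.
rewrite -(sum_ball_configS (fun s => `[< B s >])); apply: eq_bigl => s /=.
by rewrite -restrict_configS extend_configK.
Qed.

Lemma cylinder_level_le m n A : (m <= n)%N -> cylinder_level m A ->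
  cylinder_level n A /\ ball_measure n A = ball_measure m A.
Proof.
move=> mn Am; rewrite -(subnK mn); elim: (n - m)%N => // d [dA dE].
by rewrite addSn; split; [exact: cylinder_levelS|rewrite ball_measureS].
Qed.

(** The measure is computed at any level at which A is a cylinder set; [gibbs_measureE] shows
    independence of the level. Off the cylinder algebra the level defaults to 0. *)
Definition gibbs_measure A : 'Q_[p] :=
  ball_measure (xget 0%N [set n | cylinder_level n A]) A.

Lemma gibbs_measureE n A : cylinder_level n A -> gibbs_measure A = ball_measure n A.
Proof.
move=> nA; rewrite /gibbs_measure; case: xgetP => [m _ mA|/(_ n)//].
have [_ <-] := cylinder_level_le (leq_maxl m n) mA.
by have [_ <-] := cylinder_level_le (leq_maxr m n) nA.
Qed.

Lemma gibbs_measure_finitely_additive : finitely_additive gibbs_measure.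
Proof.
move=> A B [m mA] [n nB] AB0.
(* Both sets are brought to a common level, where the measures are sums over disjoint families of
   configurations. *)
have [[A' AE] _] := cylinder_level_le (leq_maxl m n) mA.
have [[B' BE] _] := cylinder_level_le (leq_maxr m n) nB.
rewrite !(@gibbs_measureE (maxn m n)); [|by exists B'|by exists A'|]; last first.
  by exists (A' `|` B'); rewrite preimage_setU -AE -BE.
rewrite /ball_measure big_mkcond [X in _ = X + _]big_mkcond.
rewrite [X in _ = _ + X]big_mkcond -big_split; apply: eq_bigr => s _ /=.
have dis : ~ (A (extend_config s) /\ B (extend_config s)).
  by move=> ABs; have : (A `&` B) (extend_config s) by []; rewrite AB0.
case: (asboolP (A _)) => As; case: (asboolP (B _)) => Bs;
  case: (asboolP ((A `|` B) _)) => ABs; rewrite ?addr0 ?add0r//.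
- by case: dis.
- by case: dis.
- by case: ABs; left.
- by case: ABs; right.
- by case: ABs.
Qed.

Lemma gibbs_measure_cylinder n (s : ball_config k q n) :
  gibbs_measure (cylinder s) = finite_gibbs J h s.
Proof.
rewrite (@gibbs_measureE n); last by exists [set s].
rewrite /ball_measure (big_pred1 s)// => s'.
by rewrite /cylinder /= extend_configK; apply/asboolP/eqP.
Qed.
End GibbsMeasure.

(** * Periodic boundary laws *)

Section PeriodicBoundaryLaw.
Variables (p q m : nat) (J h : 'Q_[p]) (S : pred 'I_q).
Hypotheses (p_prime : prime p) (p_gt2 : (2 < p)%N) (m_gt0 : (0 < m)%N).
Hypotheses (J1 : padic_abs J < 1) (h1 : padic_abs (h - 1) < 1).
Local Notation theta := (exp_p J).
Local Notation a := #|S|.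
Local Notation A := (a%:R : 'Q_[p]).
Local Notation Q := (q%:R : 'Q_[p]).
Variable z : 'I_m -> 'Q_[p].
Hypotheses (z1 : forall j, padic_abs (z j - 1) < 1)
  (z_cycle : forall j, z j = potts_map theta a q 3 (z (ordS j)))
  (z_regular : forall j, A * z j + theta + Q - A - 1 != 0)
  (z_root : forall j, A * z j + (Q - A) != 0).
Variable hh : 'I_m -> 'rV['Q_[p]]_q.
Hypothesis hhE : forall j b, hh j 0 b = ln_p (h * (if S b then z j else 1)).

Definition level_index (x : vertex 3) : 'I_m := Ordinal (ltn_pmod (root_dist x) m_gt0).

Definition periodic_function : boundary_function 3 q p := fun x => hh (level_index x).

Lemma level_index_child (i : 'I_3) y : level_index (i :: y) = ordS (level_index y).
Proof. by apply: val_inj; rewrite /= -[in RHS]addn1 modnDml addn1. Qed.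

Lemma periodic_functionP : periodic_boundary hh periodic_function.
Proof.
move=> j x xj; congr hh; apply: val_inj => /=.
by rewrite xj modn_small.
Qed.

Lemma state_near1 j b : padic_abs (h * (if S b then z j else 1) - 1) < 1.
Proof.
have near t : padic_abs (t - 1) < 1 -> padic_abs (h * t - 1) < 1.
  by move=> t1; rewrite -[X in _ - X](expr1n _ 2) padic_absM_near ?padic_abs1.
by case: ifP => _; apply: near; rewrite ?subrr ?padic_abs0.
Qed.

Lemma periodic_function_disc x b : padic_abs (periodic_function x 0 b) < 1.
Proof.
rewrite /periodic_function hhE; have := state_near1 (level_index x) b.
by set y := _ * _ => y1; rewrite -[y](subrK 1) addrC padic_abs_ln.
Qed.

Lemma periodic_spin_weight x b :
  spin_weight periodic_function x b = h * (if S b then z (level_index x) else 1).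
Proof. by rewrite /spin_weight /periodic_function hhE ln_pK// state_near1. Qed.

Lemma sum_states t : \sum_(b < q) (if S b then t else 1) = A * t + (Q - A).
Proof.
rewrite (eq_bigr (fun b => 1 + (if S b then t - 1 else 0))) => [|b _]; last first.
  by case: ifP => _; rewrite ?addr0// addrCA subrr addr0.
rewrite big_split /= -big_mkcond !sumr_const card_ord -[in LHS](mulr_natl (t - 1)).
by rewrite mulrBr mulr1 addrCA.
Qed.

(** The edge weight is theta at b = c and 1 elsewhere, so the coupling adds theta - 1 times the
    state at c to the plain sum. *)
Lemma sum_edge_states t c :
  \sum_(b < q) edge_weight J c b * (h * (if S b then t else 1)) =
  h * ((theta - 1) * (if S c then t else 1) + (A * t + (Q - A))).
Proof.
rewrite -sum_states mulrDr mulr_sumr.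
rewrite (bigD1 c)//= [in RHS](bigD1 c)//= /edge_weight eqxx mulr1.
rewrite (eq_bigr (fun b => h * (if S b then t else 1))) => [|b bc]; last first.
  by rewrite eq_sym (negbTE bc) mulr0 exp_p0 ?mul1r.
by rewrite addrA -mulrDr mulrBl mul1r subrK mulrCA.
Qed.

(** For a spin outside [S] each of the three children contributes h times the denominator of the
    Potts map; one of the three factors h is the weight of the parent's spin. *)
Definition law_constant (y : vertex 3) : 'Q_[p] :=
  h ^+ 2 * (A * z (ordS (level_index y)) + theta + Q - A - 1) ^+ 3.

Lemma h_neq0 : h != 0.
Proof. by rewrite -padic_abs_gt0 padic_abs_near1. Qed.

(** The child factors for spins in [S] and outside [S] are h times the numerator and h times the
    denominator of the Potts map. Their quotient cubed is the potts map at the next level, so the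
    law is the cycle relation. *)
Lemma periodic_boundary_law y c :
  \prod_(i < 3) \sum_(b < q)
    edge_weight J c b * spin_weight periodic_function (i :: y) b =
  law_constant y * spin_weight periodic_function y c.
Proof.
under eq_bigr => i _.
  under eq_bigr do rewrite periodic_spin_weight level_index_child.
  rewrite sum_edge_states.
  over.
rewrite prodr_const card_ord periodic_spin_weight /law_constant.
set j := level_index y; rewrite [z j]z_cycle /potts_map.
have := z_regular (ordS j); set t := z (ordS j); case: ifP => _.
  have id (F : fieldType) (g b s th x : F) : b * s + th + x - b - 1 != 0 ->
      (g * ((th - 1) * s + (b * s + (x - b)))) ^+ 3 =
      g ^+ 2 * (b * s + th + x - b - 1) ^+ 3 *
      (g * (((th + b - 1) * s + x - b) / (b * s + th + x - b - 1)) ^+ 3).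
    by move=> d0; field.
  exact: id.
have id (F : comPzRingType) (g b s th x : F) :
    (g * ((th - 1) * 1 + (b * s + (x - b)))) ^+ 3 =
    g ^+ 2 * (b * s + th + x - b - 1) ^+ 3 * (g * 1) by ring.
by move=> _; exact: id.
Qed.

Lemma periodic_gibbs_exists (R : realType) :
  exists mu : set (vertex 3 -> 'I_q) -> 'Q_[p],
    is_periodic_gibbs_measure R J hh mu.
Proof.
have disc := periodic_function_disc.
have c0 y : law_constant y != 0.
  by rewrite mulf_neq0// expf_neq0 ?h_neq0.
have root0 : \sum_(b < q) spin_weight periodic_function [::] b != 0.
  under eq_bigr do rewrite periodic_spin_weight.
  by rewrite -mulr_sumr sum_states mulf_neq0 ?h_neq0.
have comp := boundary_law_compatible p_prime p_gt2 J1 disc c0 periodic_boundary_law.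
exists (gibbs_measure J periodic_function), periodic_function.
  exact: periodic_functionP.
split.
- by move=> x i; apply/in_exp_discE.
- by move=> n;
  exact: (partition_function_neq0 p_prime p_gt2 J1 disc c0
    periodic_boundary_law root0).
- exact: comp.
- exact: gibbs_measure_finitely_additive.
- by move=> n s; rewrite gibbs_measure_cylinder.
Qed.
End PeriodicBoundaryLaw.

(** * Excluded cardinalities and passage from alpha to the q spins *)

(** If |a| <= |q|, then 1/|q|, the largest power of p dividing q, divides a. So a = j/|q| with 1 <=
    j < qs, because 0 < a < q = qs/|q|, and these values are excluded. *)
Lemma padic_abs_lt_of_card (p q qs a : nat) : prime p -> (0 < q)%N ->
  q%:R = qs%:R / padic_abs (q%:R : 'Q_[p]) :> rat -> (1 <= a < q)%N ->
  (forall j : nat, (1 <= j <= qs.-1)%N ->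
     a%:R != j%:R / padic_abs (q%:R : 'Q_[p]) :> rat) ->
  padic_abs (q%:R : 'Q_[p]) < padic_abs (a%:R : 'Q_[p]).
Proof.
move=> p_prime q0 qE /andP[a0 aq] aj; rewrite ltNge; apply/negP.
rewrite !padic_abs_natE// lef_pV2 ?posrE ?exprn_gt0 ?natp_gt0//.
rewrite ler_eXn2l ?natp_gt1// -pfactor_dvdn// => /dvdnP[j jE].
move: qE aj; rewrite padic_abs_natE// invrK -natrX -natrM => /eqP.
rewrite eqr_nat => /eqP qE aj.
have pn0 : (0 < p ^ logn p q)%N by rewrite expn_gt0 prime_gt0.
have jqs : (j < qs)%N by rewrite -(ltn_pmul2r pn0) -jE -qE.
have j0 : (0 < j)%N by move: a0; rewrite jE muln_gt0 => /andP[].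
have := aj j; rewrite j0 -natrM -jE eqxx => /(_ _)/negP; apply=> //.
by rewrite -ltnS prednK// (leq_ltn_trans _ jqs).
Qed.

Theorem theorem3p3 (R : realType) (p q qs m : nat) (J theta : 'Q_[p])
  (p_prime : prime p) (p_mod3 : p = 1 %[mod 3])
  (q_ge2 : (2 <= q)%N)
  (J_disc : in_exp_disc R J) (theta_def : theta = exp_p J)
  (theta_gt0 : 0 < padic_abs (theta - 1))
  (theta_lt : padic_abs (theta - 1) < padic_abs (q%:R : 'Q_[p]))
  (q_lt1 : padic_abs (q%:R : 'Q_[p]) < 1)
  (qs_def : q%:R = qs%:R / padic_abs (q%:R : 'Q_[p]) :> rat)
  (qs_coprime : ~~ (p %| qs)%N)
  (m_ge1 : (1 <= m)%N) :
  forall (h : 'Q_[p]) (alpha beta : {set 'I_q.-1}),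
    Ep R h ->
    alpha :|: beta = [set: 'I_q.-1]%SET -> [disjoint alpha & beta] ->
    (1 <= #|alpha|)%N ->
    (forall j : nat, (1 <= j <= qs.-1)%N ->
       #|alpha|%:R != j%:R / padic_abs (q%:R : 'Q_[p]) :> rat) ->
    exists z : 'I_m -> 'Q_[p],
      [/\ forall j, Ep R (z j),
          is_cycle (potts_map theta #|alpha| q 3) z &
          let zvec := fun j : 'I_m =>
            z j *: indicator_vec p alpha + indicator_vec p beta in
          (forall j i, Ep R (zvec j 0 i)) /\
          exists mu : set (vertex 3 -> 'I_q) -> 'Q_[p],
            is_periodic_gibbs_measure R J (fun j => boundary_vec h (zvec j))
              mu].
Proof.
move=> h alpha beta h_Ep ab_cover ab_disj alpha_gt0 alpha_notin.
have p3 := prime_mod3_gt3 p_prime p_mod3; have p2 := ltnW p3.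
have nearE (x : 'Q_[p]) : Ep R x <-> padic_abs (x - 1) < 1.
  exact: in_exp_discE.
have h1 : padic_abs (h - 1) < 1 by apply/nearE.
have J1 : padic_abs J < 1 by apply/(in_exp_discE p_prime R).
have q0 := ltnW q_ge2.
have alpha_q : (1 <= #|alpha| < q)%N.
  by rewrite alpha_gt0 (leq_ltn_trans (max_card _))// card_ord ltn_predL.
have q_alpha := padic_abs_lt_of_card p_prime q0 qs_def alpha_q alpha_notin.
have tau0 : theta - 1 != 0 by rewrite -padic_abs_gt0.
have [z [z1 [z_inj z_cycle] z_reg z_root]] :=
  potts_cycle_exists p_prime p_mod3 tau0 theta_lt q_alpha m_ge1.
have zvecE j i : (z j *: indicator_vec p alpha + indicator_vec p beta) 0 i =
    if i \in alpha then z j else 1.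
  rewrite !mxE; have := finset.in_setT i; rewrite -ab_cover finset.in_setU.
  have := disjointFr ab_disj (x := i).
  by case: (i \in alpha) => [->//|_ /= ->]; rewrite ?mulr1 ?addr0 ?mulr0 ?add0r.
have zvec1 j i :
    padic_abs ((z j *: indicator_vec p alpha + indicator_vec p beta) 0 i - 1) < 1.
  by rewrite zvecE; case: ifP => _ //; rewrite subrr padic_abs0.
exists z; split; first by move=> j; apply/nearE.
- by split.
split=> [j i|]; first exact/nearE.
(* [S] is [alpha] viewed among all q spins: [insub] fails exactly at the last spin, whose boundary
   component is ln h and which lies outside [S]. *)
pose S (b : 'I_q) := if insub (b : nat) is Some i then i \in alpha else false.
have cardS : #|S| = #|alpha|.
  have widen_inj : injective (widen_ord (leq_pred q)).
    by move=> i i' /(congr1 val) ?; exact: val_inj.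
  rewrite -(card_imset _ widen_inj).
  apply: eq_card => b; rewrite [LHS]/in_mem /= /S; case: insubP => [i _ ib|bq].
    apply/idP/imsetP => [ia|[i' i'a bE]]; first by exists i => //; exact: val_inj.
    by rewrite (_ : i = i')//; apply: val_inj; rewrite ib bE.
  by apply/esym/imsetP => -[i' _ bE]; rewrite bE /= ltn_ord in bq.
rewrite theta_def -cardS in z_cycle z_reg z_root *.
apply: (periodic_gibbs_exists (S := S) p_prime p2 m_ge1 J1 h1 z1) => // j b.
rewrite mxE /S; case: insubP => [i _ _|_]; first by rewrite zvecE.
by rewrite mulr1.
Qed.
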